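(* Let $X_t=\mu t+\sigma W_t$ with $\mu\in\mathbb{R}$, $\sigma>0$, let $a>0$, and let $\tau_a^n$ be the $n$-th drawdown time without recovery. For all $\lambda>0$, $n\in\mathbb{N}$ and $x>0$, $$\mathbb{E}\left[e^{-\lambda\tau_a^n};\,M_{\tau_a^n}>x\right]=\left(\frac{c_\lambda}{b_\lambda}\right)^n\sum_{m=0}^{n-1}\frac{x(x+ma)^{m-1}b_\lambda^m}{m!}\,e^{-b_\lambda(ma+x)}.$$
   Context: $X_t=\mu t+\sigma W_t$ ($X_0=0$) with $W$ a standard Brownian motion, $\mu\in\mathbb{R}$, $\sigma>0$; $M_t=\sup_{0\le s\le t}X_s$ is the (global) running maximum; $a>0$ is fixed; $M_{[s,t]}=\sup_{s\le u\le t}X_u$; $\mathbb{N}=\{1,2,\dots\}$; $\inf\emptyset=\infty$. The drawdown times without recovery are defined by $\tau_a^0=0$ and $$\tau_a^n=\inf\{t>\tau_a^{n-1}:\ M_{[\tau_a^{n-1},t]}-X_t\ge a\}.$$ Notation: $\mathbb{E}[Y;U]=\mathbb{E}[Y1_U]$; the $m=0$ factor $x(x+ma)^{m-1}$ equals $1$. Constants: $\beta_\lambda^{\pm}=\dfrac{-\mu\pm\sqrt{\mu^2+2\lambda\sigma^2}}{\sigma^2}$, $b_\lambda=\dfrac{\beta_\lambda^+e^{-\beta_\lambda^-a}-\beta_\lambda^-e^{-\beta_\lambda^+a}}{e^{-\beta_\lambda^-a}-e^{-\beta_\lambda^+a}}$, $c_\lambda=\dfrac{\beta_\lambda^+-\beta_\lambda^-}{e^{-\beta_\lambda^-a}-e^{-\beta_\lambda^+a}}$.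 *)

(* Defs.v *)
From HB Require Import structures.
From mathcomp Require Import all_boot all_order all_algebra.
From mathcomp Require Import all_classical all_reals all_analysis.
Set Implicit Arguments.
Unset Strict Implicit.
Unset Printing Implicit Defensive.
Import Order.TTheory GRing.Theory Num.Theory.
Import numFieldNormedType.Exports.
Local Open Scope classical_set_scope.
Local Open Scope ring_scope.

(* Choosing [B i = setT] recovers the product rule for every subfamily. *)
Definition mutually_independent d (T : measurableType d) (R : realType)
    (P : probability T R) n (Y : 'I_n -> T -> R) : Prop :=
  forall B : 'I_n -> set R, (forall i, measurable (B i)) ->
    P (\bigcap_(i in [set: 'I_n]) (Y i @^-1` B i)) =
    (\prod_(i < n) P (Y i @^-1` B i))%E.

(* The time index is the whole of [R], but only times [t >= 0] are constrained
   or used.  The second parameter of [normal_prob] is a standard deviation. *)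
Record standard_brownian_motion d (T : measurableType d) (R : realType)
    (P : probability T R) (W : R -> {RV P >-> R}) : Prop := {
  sbm_start : {ae P, forall w, W 0 w = 0} ;
  sbm_continuous :
    {ae P, forall w, {within `[0, +oo[%classic, continuous (fun t => W t w)}} ;
  sbm_gaussian : forall s t : R, 0 <= s -> s < t ->
    forall B : set R, measurable B ->
      P ((fun w => W t w - W s w) @^-1` B) = normal_prob 0 (Num.sqrt (t - s)) B ;
  sbm_independent : forall (n : nat) (t : nat -> R), 0 <= t 0%N ->
    (forall i, (i < n)%N -> t i < t i.+1) ->
    mutually_independent P
      (fun (i : 'I_n) w => W (t i.+1) w - W (t i) w)
}.

Definition drifted_path (T : Type) (R : realType) (mu sigma : R)
    (W : R -> T -> R) (w : T) : R -> R :=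
  fun t => mu * t + sigma * W t w.

(* [sup_{s <= u <= t} x u]; [s] and [t] may be infinite because drawdown times
   may be. *)
Definition running_max (R : realType) (x : R -> R) (s t : \bar R) : \bar R :=
  ereal_sup [set (x u)%:E | u in [set u : R | (s <= u%:E)%E /\ (u%:E <= t)%E]].

Fixpoint drawdown_time (R : realType) (a : R) (x : R -> R) (n : nat) : \bar R :=
  if n is n'.+1 then
    ereal_inf [set t%:E | t in [set t : R |
      (drawdown_time a x n' < t%:E)%E /\
      (a%:E <= running_max x (drawdown_time a x n') t%:E - (x t)%:E)%E]]
  else 0%E.

(* [exp(- lambda s)], equal to [0] at [s = +oo]. *)
Definition discount (R : realType) (lambda : R) (s : \bar R) : R :=
  fine (expeR (- (lambda%:E * s))%E).

(* [E[Y; U] = E[Y 1_U]] *)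
Definition expectation_on d (T : measurableType d) (R : realType)
    (P : probability T R) (Y : T -> R) (U : set T) : \bar R :=
  'E_P[fun w => (Y w * \1_U w)%R]%E.

Section constants.
Variables (R : realType) (mu sigma : R).

Definition beta_plus (lambda : R) : R :=
  (- mu + Num.sqrt (mu ^+ 2 + 2 * lambda * sigma ^+ 2)) / sigma ^+ 2.

Definition beta_minus (lambda : R) : R :=
  (- mu - Num.sqrt (mu ^+ 2 + 2 * lambda * sigma ^+ 2)) / sigma ^+ 2.

Definition b_coef (a lambda : R) : R :=
  (beta_plus lambda * expR (- beta_minus lambda * a)
   - beta_minus lambda * expR (- beta_plus lambda * a))
  / (expR (- beta_minus lambda * a) - expR (- beta_plus lambda * a)).

Definition c_coef (a lambda : R) : R :=
  (beta_plus lambda - beta_minus lambda)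
  / (expR (- beta_minus lambda * a) - expR (- beta_plus lambda * a)).

End constants.

(* Main.v *)
Require Import Defs.
From HB Require Import structures.
From mathcomp Require Import all_boot all_order all_algebra.
From mathcomp Require Import all_classical all_reals all_analysis.
From mathcomp Require Import measurable_realfun ring lra.
Set Implicit Arguments.
Unset Strict Implicit.
Unset Printing Implicit Defensive.
Import Order.TTheory GRing.Theory Num.Theory.
Import numFieldNormedType.Exports.
Local Open Scope classical_set_scope.
Local Open Scope ring_scope.

(** Sample the path on a grid of mesh [h].  The grid chain that records the
    discount, the number [j] of drawdowns left, the distance [y] from the maximum
    of the current stage to [x] and the current drawdown [D] is a Markov chain
    driven by independent Gaussian increments.  Its value function is
    [A(D) F_j(y) + B(D) F_(j-1)(y+a)], where [A] and [B] are the combinations of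
    [exp(- beta^+ D)] and [exp(- beta^- D)] with [A(0) = B(a) = 1] and
    [A(a) = B(0) = 0], and [F_j' = - b F_j + c F_(j-1)(. + a)]: this is an equation
    between Abel polynomials.  Both exponentials are exact eigenfunctions of the
    Gaussian step with eigenvalue [exp(lambda h)], so the value function fails to be
    an eigenfunction only when a step raises the maximum by some [t] (error
    [O(t^2)], because [A'(0) = - b] and [B'(0) = c]), makes it cross [x], or
    completes a drawdown (error of the size of the step).  These errors are
    dominated by the decrease of the potential [exp(- beta^+ D) + 2 j + 1_(y >= 0)],
    hence vanish as [h -> 0].

    In the other direction [drawdown_time] is monotone in [a]; grid drawdowns of
    size [a] are genuine drawdowns, and genuine drawdowns of size [a] are
    eventually seen on the grid as drawdowns of any smaller size.  So the grid
    expectations at levels slightly below and above [a] squeeze the expectation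
    sought, by Fatou's lemma and the continuity of the formula in [(a, x)]. *)

(** * Gaussian exponential moments *)

(** The number of grid steps tends to infinity, so a fixed bound per step cannot suffice. A step of
    size at most [del] costs at most a constant times [del] times the loss of potential compared
    with free evolution. Free evolution does not raise the discounted mean of the potential: its
    exponential is an eigenfunction and the rest only shrinks. Up to the effect of long steps, the
    expected losses therefore add up to at most the initial value [2 n + 2], and all short steps
    together cost [O(del)]. Steps longer than [del] are dominated by multiples of
    [exp(- kap del) exp((p + q + kap) |z|)], with [p = beta^+] and [q = - beta^-]; the two signs of
    [z] turn this into exponentials with explicit Gaussian means.

    In the limit, a grid payoff is comparable with the discount only after a small change of level.
    This gap is paid for by auxiliary walks that start with a negative distance: their target counts
    as exceeded from the outset, so their payoff is the discount alone. Fatou's lemma is applied to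
    measurable combinations of three payoffs, and the integrand of the theorem is only compared with
    their lower limits. *)

Section gaussian_mgf.
Context {R : realType}.
Implicit Types (s t : R).
Notation lebesgue := (@lebesgue_measure R).

(** The density and the Radon-Nikodym derivative of [normal_prob] have the same integral over every
    measurable set, hence agree almost everywhere. *)
Lemma ge0_integral_normal_prob s f : s != 0 ->
  measurable_fun [set: R] f -> (forall x, (0 <= f x)%E) ->
  (\int[normal_prob 0 s]_x f x =
   \int[lebesgue]_x (f x * (normal_pdf 0 s x)%:E))%E.
Proof.
move=> s0 mf f0.
have dom := normal_prob_dominates (0 : R) s.
rewrite -(@Radon_Nikodym_SigmaFinite.change_of_variables _ _ _ _ _ dom f setT)//.
have intRN := Radon_Nikodym_SigmaFinite.f_integrable dom.
apply: ae_eq_integral => //.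
- by apply: emeasurable_funM => //; exact: (measurable_int _ intRN).
- apply: emeasurable_funM => //; apply/measurable_EFinP.
  exact: measurable_normal_pdf.
apply: ae_eqe_mul2l => /=.
apply: integral_ae_eq => //=.
- by apply/measurable_EFinP; exact: measurable_normal_pdf.
- by move=> E _ mE; rewrite -Radon_Nikodym_SigmaFinite.f_integral.
Qed.

(** Completing the square: an exponential weight shifts a centred Gaussian density, up to the factor
    that becomes its moment generating function. *)
Lemma normal_pdf_tilt s t x : s != 0 ->
  expR (t * x) * normal_pdf 0 s x =
  expR (t ^+ 2 * s ^+ 2 / 2) * normal_pdf (t * s ^+ 2) s x.
Proof.
move=> s0; rewrite !normal_pdfE// /normal_fun.
rewrite mulrCA [RHS]mulrCA -!expRD; congr (_ * expR _); field.
by rewrite s0.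
Qed.

Lemma integral_normal_expR s t : s != 0 ->
  (\int[normal_prob 0 s]_x (expR (t * x))%:E =
   (expR (t ^+ 2 * s ^+ 2 / 2))%:E)%E.
Proof.
move=> s0; rewrite ge0_integral_normal_prob//; last first.
  by apply/measurable_EFinP; apply: measurableT_comp => //.
under eq_integral do rewrite -EFinM normal_pdf_tilt// EFinM.
rewrite ge0_integralZl//=; last 2 first.
- by apply/measurable_EFinP; exact: measurable_normal_pdf.
- by move=> x _; rewrite lee_fin normal_pdf_ge0.
by rewrite integral_normal_pdf mule1.
Qed.

Lemma integrable_normal_expR s t : s != 0 ->
  (normal_prob 0 s).-integrable setT (fun x => (expR (t * x))%:E).
Proof.
move=> s0; apply/integrableP; split.
  by apply/measurable_EFinP; apply: measurableT_comp => //.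
under eq_integral do rewrite gee0_abs ?lee_fin ?expR_ge0//.
by rewrite integral_normal_expR// ltry.
Qed.

End gaussian_mgf.

(** * Chains driven by independent increments *)

Lemma bounded_integrable d (T : measurableType d) (R : realType)
    (mu : {finite_measure set T -> \bar R}) (f : T -> R) (C : R) :
  measurable_fun setT f -> (forall x, `|f x| <= C) ->
  mu.-integrable setT (EFin \o f).
Proof.
move=> mf fC; apply: measurable_bounded_integrable => //.
  by rewrite -ge0_fin_numE// fin_num_measure.
exists C; split; first exact: num_real.
by move=> M CM x _; exact: le_trans (fC x) (ltW CM).
Qed.

Fixpoint chain (T S Z : Type) (xi : nat -> T -> Z) (step : S * Z -> S) (s0 : S)
    (k : nat) (w : T) : S :=
  if k is k'.+1 then step (chain xi step s0 k' w, xi k' w) else s0.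

Section driven_chain.
Context d (T : measurableType d) (R : realType) (P : probability T R).
Context dS (S : measurableType dS).
Variables (nu : probability (measurableTypeR R) R) (xi : nat -> T -> R).
Hypothesis mxi : forall i, measurable_fun [set: T] (xi i).
Hypothesis indep_xi : forall n (B : nat -> set R),
  (forall i, measurable (B i)) ->
  P (\bigcap_(i in `I_n) xi i @^-1` B i) = (\prod_(0 <= i < n) nu (B i))%E.
Variables (step : S * R -> S) (s0 : S).
Hypothesis mstep : measurable_fun [set: S * measurableTypeR R] step.

Local Notation chain := (chain xi step s0).

Lemma measurable_chain k : measurable_fun [set: T] (chain k).
Proof.
elim: k => [|k IH]; first exact: measurable_cst.
apply: (measurableT_comp mstep).
exact: (measurable_fun_pair IH (mxi k)).
Qed.

Let future k n (B : nat -> set R) : set T :=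
  \bigcap_(i in `I_n) xi (k + i)%N @^-1` B i.

Let measurable_future k n (B : nat -> set R) :
  (forall i, measurable (B i)) -> measurable (future k n B).
Proof.
move=> mB; apply: bigcap_measurableType => // i _.
by rewrite -[X in measurable X]setTI; exact: mxi.
Qed.

Let future_cons k n (B : nat -> set R) : future k n.+1 B =
  xi k @^-1` B 0%N `&` future k.+1 n (fun i => B i.+1).
Proof.
apply/seteqP; split => [w /= Bw|w [/= B0 Bw] [|i] /= lt_in].
- split; first by have := Bw 0%N isT; rewrite addn0.
  by move=> i /= lt_in; have := Bw i.+1 lt_in; rewrite /= addSnnS.
- by rewrite addn0.
- by have := Bw i lt_in; rewrite /= addSnnS.
Qed.

(** Independence is given only for finite products of events, so the induction carries an arbitrary
    finite future along. The joint law of [(chain k, xi k)], even restricted to a later event, then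
    agrees with a product measure on rectangles, hence everywhere. *)
Lemma chain_future k n (A : set S) (B : nat -> set R) : measurable A ->
  (forall i, measurable (B i)) ->
  P (chain k @^-1` A `&` future k n B) =
  (P (chain k @^-1` A) * \prod_(0 <= i < n) nu (B i))%E.
Proof.
elim: k n A B => [|k IH] n A B mA mB.
  have [As0|As0] := pselect (A s0).
    have -> : chain 0 @^-1` A = setT by apply/seteqP; split.
    by rewrite setTI probability_setT mul1e -indep_xi.
  have -> : chain 0 @^-1` A = set0 by apply/seteqP; split.
  by rewrite set0I measure0 mul0e.
pose g w : S * measurableTypeR R := (chain k w, xi k w).
have mg : measurable_fun setT g.
  exact: (measurable_fun_pair (measurable_chain k) (mxi k)).
pose c : R := fine (\prod_(0 <= i < n) nu (B i))%E.
have cE : (\prod_(0 <= i < n) nu (B i))%E = c%:E.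
  rewrite fineK//.
  apply: (big_ind (fun x => x \is a fin_num)); [by []|exact: fin_numM|].
  by move=> i _; exact: (fin_num_measure nu _ (mB i)).
have c0 : 0 <= c.
  by apply: fine_ge0; apply: prode_ge0 => i _; exact: measure_ge0.
have mE := @measurable_future k.+1 n B mB.
pose m' := measure_function_pushforward__canonical__measure_function_Measure (mrestr P mE) mg.
pose Ug : {mfun T >-> S} := HB.pack (chain k) (isMeasurableFun.Build _ _ _ _ (chain k) (measurable_chain k)).
pose muU := distribution P Ug.
pose cn : {nonneg R} := NngNum c0.
have mgX (X : set (S * measurableTypeR R)) : measurable X ->
    P (g @^-1` X) = (muU \x nu)%E X.
  move=> mX; apply/esym.
  pose m1 := measure_function_pushforward__canonical__measure_function_Measure P mg.
  apply: (@product_measure_unique _ _ _ _ _ muU nu m1) => //.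
  move=> C1 C2 mC1 mC2; rewrite /m1 /= /pushforward.
  have := IH 1%N C1 (fun=> C2) mC1 (fun=> mC2).
  rewrite big_nat1 => <-; congr (P _).
  apply/seteqP; split => [w /= [Cw1 Cw2]|w /= [Cw1 Cw2]]; split => //.
    by case=> // _; rewrite /= addn0.
  by have := Cw2 0%N isT; rewrite /= addn0.
(* Restricting [P] to the future event multiplies masses by the constant [c]; [mscale cn nu] puts
   this factor on the last coordinate. *)
have mgE (X : set (S * measurableTypeR R)) : measurable X ->
    P (g @^-1` X `&` future k.+1 n B) = (muU \x mscale cn nu)%E X.
  move=> mX; apply/esym.
  apply: (@product_measure_unique _ _ _ _ _ muU (mscale cn nu) m') => //.
  move=> C1 C2 mC1 mC2; rewrite /m' /= /pushforward /mrestr.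
  (* Prepending [C2] turns the event on [xi k] into the first event of a longer future, to which the
     induction hypothesis applies. *)
  pose B' i := if i is i'.+1 then B i' else C2.
  have mB' i : measurable (B' i) by case: i => //=.
  have := IH n.+1 C1 B' mC1 mB'.
  rewrite future_cons big_nat_recl// -/muU /= cE.
  rewrite -/(mscale cn nu) => E.
  rewrite (_ : mscale cn nu C2 = nu C2 * c%:E)%E; last by rewrite muleC.
  rewrite [RHS](_ : _ = P (chain k @^-1` C1) * (nu C2 * c%:E))%E//.
  by rewrite -E setIA.
have mX : measurable (step @^-1` A) by rewrite -[X in measurable X]setTI; exact: mstep.
rewrite (_ : chain k.+1 @^-1` A = g @^-1` (step @^-1` A))//.
rewrite mgE// mgX// cE muleC /product_measure1 -ge0_integralZl//=.
- exact: measurable_fun_xsection.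
Qed.

(** The Markov property in integrated form: by [chain_future] with a future of length one,
    [(chain k, xi k)] has a product law, and Fubini's theorem integrates the fresh step first. *)
Lemma integral_chain_step k (f : S * R -> R) (C : R) :
  measurable_fun [set: S * measurableTypeR R] f -> (forall x, `|f x| <= C) ->
  P.-integrable setT (fun w => \int[nu]_z (f (chain k w, z))%:E)%E /\
  (\int[P]_w (f (chain k w, xi k w))%:E =
   \int[P]_w \int[nu]_z (f (chain k w, z))%:E)%E.
Proof.
move=> mf fC.
pose g w : S * measurableTypeR R := (chain k w, xi k w).
have mg : measurable_fun setT g.
  exact: (measurable_fun_pair (measurable_chain k) (mxi k)).
pose Ug : {mfun T >-> S} :=
  HB.pack (chain k) (isMeasurableFun.Build _ _ _ _ (chain k) (measurable_chain k)).
pose Gg : {mfun T >-> (S * measurableTypeR R)%type} :=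
  HB.pack g (isMeasurableFun.Build _ _ _ _ g mg).
pose muU := distribution P Ug.
have lawE (X : set (S * measurableTypeR R)) : measurable X ->
    distribution P Gg X = (muU \x nu)%E X.
  move=> mX; apply/esym.
  apply: (@product_measure_unique _ _ _ _ _ muU nu (distribution P Gg)) => //.
  move=> C1 C2 mC1 mC2; rewrite /distribution /= /pushforward.
  have := @chain_future k 1%N C1 (fun=> C2) mC1 (fun=> mC2).
  rewrite big_nat1 => <-; congr (P _).
  apply/seteqP; split => [w /= [Cw1 Cw2]|w /= [Cw1 Cw2]]; split => //.
    by case=> // _; rewrite /= addn0.
  by have := Cw2 0%N isT; rewrite /= addn0.
have mEf : measurable_fun [set: S * measurableTypeR R] (EFin \o f).
  exact/measurable_EFinP.
have int_f : (muU \x nu)%E.-integrable setT (EFin \o f).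
  apply: measurable_bounded_integrable => //.
    have lawT := lawE setT measurableT; rewrite probability_setT in lawT.
    by rewrite [X in (X < _)%E](_ : _ = 1%E) ?ltry// lawT.
  exists C; split; first exact: num_real.
  by move=> M CM x _; exact: le_trans (fC x) (ltW CM).
have mF := measurable_fubini_F int_f.
have C0 : 0 <= C by apply: le_trans (fC (s0, 0)).
have mf2 s : measurable_fun [set: measurableTypeR R] (fun z => f (s, z)).
  exact: measurable_fun_pair2.
have int_mean : P.-integrable setT (fun w => \int[nu]_z (f (chain k w, z))%:E)%E.
  apply: (@le_integrable _ _ _ P setT measurableT _ (cst C%:E)) => //=.
  - exact: (measurableT_comp mF (measurable_chain k)).
  - move=> w _; apply: le_trans (le_abse_integral _ _ _) _ => //.
      by apply/measurable_EFinP.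
    apply: (@le_trans _ _ (C%:E * nu setT)%E).
      apply: integral_le_bound => //; first exact/measurable_EFinP.
      by apply: aeW => z _; exact: fC.
    by rewrite probability_setT mule1 lee_fin ler_norm.
  - exact: finite_measure_integrable_cst.
split=> //.
transitivity (\int[distribution P Gg]_x (f x)%:E)%E.
  rewrite (integral_pushforward mg mEf) //=.
  rewrite preimage_setT; apply: (@bounded_integrable _ _ _ _ _ C) => //.
  exact: measurableT_comp.
transitivity (\int[muU \x nu]_x (f x)%:E)%E.
  by apply: eq_measure_integral => A mA _; exact: lawE.
rewrite -(integral12_prod_meas1 int_f) /=.
rewrite (integral_pushforward (measurable_chain k) mF) //= preimage_setT.
Qed.

(** Each step raises the mean by at most [rho]. The drift is asked on an invariant set only, because
    below it is established on admissible states only. *)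
Lemma expectation_chain_le (phi : S -> R) (C rho : R) (inv : S -> Prop) N :
  measurable_fun [set: S] phi -> (forall s, `|phi s| <= C) ->
  inv s0 -> (forall s z, inv s -> inv (step (s, z))) ->
  (forall s, inv s -> (\int[nu]_z (phi (step (s, z)))%:E <= (phi s + rho)%:E)%E) ->
  (\int[P]_w (phi (chain N w))%:E <= (phi s0 + N%:R * rho)%:E)%E.
Proof.
move=> mphi phiC inv0 invS drift.
have inv_chain k w : inv (chain k w).
  by elim: k => [//|k IH]; exact: invS.
have int_phi k : P.-integrable setT (fun w => (phi (chain k w))%:E).
  apply: (@bounded_integrable _ _ _ _ (phi \o chain k) C) => [|w].
  - by apply: measurableT_comp => //; exact: measurable_chain.
  - exact: phiC.
elim: N => [|N IH].
  by rewrite mul0r addr0 /= integral_cst//= probability_setT mule1.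
rewrite -natr1 mulrDl mul1r addrA EFinD.
have mphistep : measurable_fun [set: S * measurableTypeR R] (fun x => phi (step x)).
  exact: measurableT_comp.
have [int_mean ->] := @integral_chain_step N (phi \o step) C mphistep (fun=> phiC _).
apply: (@le_trans _ _ (\int[P]_w (phi (chain N w) + rho)%:E)%E); last first.
  under eq_integral do rewrite EFinD.
  rewrite integralD//=; last exact: finite_measure_integrable_cst.
  rewrite integral_cst//= probability_setT mule1 leeD2r//.
apply: le_integral => //=.
- under eq_fun do rewrite EFinD.
  by apply: integrableD => //; exact: finite_measure_integrable_cst.
- by move=> w _; exact: drift.
Qed.

End driven_chain.

(** * Abel polynomials *)

Section mean_value_bounds.
Context {R : realType}.
Implicit Types (f df : R -> R).

Lemma is_derive_continuous f df : (forall x : R, is_derive x 1 f (df x)) ->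
  continuous f.
Proof.
move=> fdf x; have [fx _] := fdf x.
exact/differentiable_continuous/derivable1_diffP.
Qed.

Lemma mean_value f df (u v : R) : u <= v ->
  (forall x : R, is_derive x 1 f (df x)) ->
  exists c, [/\ u <= c, c <= v & f v - f u = df c * (v - u)].
Proof.
move=> uv fdf.
have cf : {within `[u, v], continuous f}.
  exact/continuous_subspaceT/(is_derive_continuous fdf).
have [c cuv fE] := MVT_segment uv (fun x _ => fdf x) cf.
by exists c; split=> //; move: cuv; rewrite in_itv /= => /andP[].
Qed.

Lemma expRB1_le (x K : R) : `|x| <= K -> `|expR x - 1| <= `|x| * expR K.
Proof.
move=> xK.
have [x0|x0] := leP 0 x.
- have e1 : 0 <= expR x - 1 by rewrite subr_ge0 -expR0 ler_expR.
  rewrite !ger0_norm// in xK *.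
  apply: (@le_trans _ _ (x * expR x)); last by rewrite ler_wpM2l// ler_expR.
  have := ler_wpM2l (expR_ge0 x) (expR_ge1Dx (- x)).
  by rewrite -expRD subrr expR0; lra.
- have e1 : expR x - 1 <= 0 by rewrite subr_le0 -expR0 ler_expR ltW.
  rewrite ler0_norm// ltr0_norm//.
  have K0 : 0 <= K by apply: le_trans xK.
  have := expR_ge1Dx x; have eK : 1 <= expR K by rewrite -expR0 ler_expR.
  have : - x * 1 <= - x * expR K by rewrite ler_wpM2l// oppr_ge0 ltW.
  lra.
Qed.

Lemma expRB1B_le (x K : R) : `|x| <= K ->
  `|expR x - 1 - x| <= x ^+ 2 * expR K.
Proof.
move=> xK; have ge0 : 0 <= expR x - 1 - x.
  by have := expR_ge1Dx x; lra.
rewrite ger0_norm//.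
(* Multiplying [1 - x <= exp (- x)] by [exp x] gives [exp x - 1 <= x exp x]. *)
have : expR x - 1 - x <= x * (expR x - 1).
  have := ler_wpM2l (expR_ge0 x) (expR_ge1Dx (- x)).
  by rewrite -expRD subrr expR0; lra.
move=> /le_trans; apply.
apply: le_trans (ler_norm _) _; rewrite normrM.
apply: le_trans (ler_wpM2l (normr_ge0 _) (expRB1_le xK)) _.
by rewrite mulrA -expr2 real_normK// num_real.
Qed.

End mean_value_bounds.

Section abel_sums.
Context {R : realType}.
Variables (a b : R).
Hypotheses (a0 : 0 < a) (b0 : 0 < b).

(* The case [m = 0] is separate because [y * y^-1] is [0], not [1], at [y = 0]. *)
Definition abel (m : nat) (y : R) : R :=
  if m is m'.+1 then y * (y + m%:R * a) ^+ m' / m`!%:R else 1.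

(** The sum of the theorem without [(c / b) ^ j]. It solves [G_j' = b G_(j-1)(. + a) - b G_j] with
    [G_j(0) = 1] for [j > 0] and [G_0 = 0]. So for [y >= 0] it is the probability that one of [j]
    stages, each climbing an exponential height of rate [b] and then falling by [a], gets above
    [y]. *)
Definition abel_sum (j : nat) (y : R) : R :=
  \sum_(0 <= m < j) (b * expR (- b * a)) ^+ m * abel m y * expR (- b * y).

(** The characteristic property of Abel polynomials: differentiation lowers the index and translates
    by [a]. *)
Lemma is_derive_abelS m (y : R) :
  is_derive y 1 (abel m.+1) (abel m (y + a)).
Proof.
have -> : abel m.+1 =
    (id * (id + cst (m.+1%:R * a)) ^+ m) * cst (m.+1`!%:R^-1) :> (R -> R).
  by apply/funext => z; rewrite /abel !fctE.
apply: is_derive_eq; rewrite !fctE /= scaler0 add0r.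
rewrite !scaler1 addr0 /GRing.scale /=.
case: m => [|m] /=.
  by rewrite !mul0r mulr0 add0r expr0 mulr1 invr1.
rewrite factS natrM invfM (_ : y + a + m.+1%:R * a = y + m.+2%:R * a); last first.
  by rewrite -[m.+2%:R]natr1; ring.
set Y := _ ^+ m; rewrite exprS -/Y.
have m2 : m.+2%:R != 0 :> R by rewrite pnatr_eq0.
have f0 : (m.+1)`!%:R != 0 :> R by rewrite pnatr_eq0 -lt0n fact_gt0.
move: m2; rewrite -[m.+2%:R]natr1 => m2.
by field; rewrite f0 -nat1r in m2 *; rewrite m2.
Qed.

Lemma is_derive_expRM (k y : R) :
  is_derive y 1 (fun z => expR (k * z)) (k * expR (k * y)).
Proof.
have : is_derive y 1 ( *%R k) k.
  have -> : *%R k = cst k * id :> (R -> R) by apply/funext.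
  by apply: is_derive_eq; rewrite scaler0 addr0 scaler1.
move=> dk; have := is_derive1_comp (is_derive_expR (k * y)) dk.
by rewrite mulrC.
Qed.

Lemma abel_ge0 m y : 0 <= y -> 0 <= abel m y.
Proof.
case: m => [//|m] y0 /=.
rewrite divr_ge0// mulr_ge0// exprn_ge0// addr_ge0// mulr_ge0//; exact: ltW.
Qed.

Lemma abel_sum0 y : abel_sum 0 y = 0.
Proof. by rewrite /abel_sum big_geq. Qed.

Lemma abel_sumS_at0 j : abel_sum j.+1 0 = 1.
Proof.
rewrite /abel_sum big_nat_recl// mulr0 expR0 !mulr1 expr0.
by rewrite big1 ?addr0// => m _; rewrite /abel !mul0r mulr0 mul0r.
Qed.

Lemma abel_sum_ge0 j y : 0 <= y -> 0 <= abel_sum j y.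
Proof.
move=> y0; rewrite /abel_sum; apply: sumr_ge0 => m _.
by rewrite !mulr_ge0 ?expR_ge0 ?abel_ge0// exprn_ge0// mulr_ge0 ?expR_ge0// ltW.
Qed.

Lemma is_derive_abel_sumS j (y : R) :
  is_derive y 1 (abel_sum j.+1) (b * abel_sum j (y + a) - b * abel_sum j.+1 y).
Proof.
elim: j => [|j IH].
  rewrite abel_sum0 mulr0 sub0r.
  have -> : abel_sum 1 = (fun z => expR (- b * z)).
    by apply/funext => z; rewrite /abel_sum big_nat1 expr0 /abel !mul1r.
  by rewrite -mulNr; exact: is_derive_expRM.
pose k : R := (b * expR (- b * a)) ^+ j.+1.
have -> : abel_sum j.+2 =
    abel_sum j.+1 + cst k * (abel j.+1 * (fun z => expR (- b * z))) :> (R -> R).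
  by apply/funext => z; rewrite /abel_sum big_nat_recr //= -mulrA.
have dE := is_derive_expRM (- b) y.
apply: (is_derive_eq (is_deriveD IH (is_deriveM (is_derive_cst k y 1)
  (is_deriveM (is_derive_abelS j y) dE)))).
rewrite !fctE /= scaler0 addr0 /GRing.scale /=.
have -> : abel_sum j.+1 (y + a) = abel_sum j (y + a) +
    (b * expR (- b * a)) ^+ j * abel j (y + a) * (expR (- b * y) * expR (- b * a)).
  by rewrite -expRD -mulrDr /abel_sum big_nat_recr.
rewrite /k exprS; ring.
Qed.

(** With the integrating factor [exp (b y)], the function [exp (b y) (1 - G_(j+1)(y))] vanishes at
    [0], and its derivative [b exp (b y) (1 - G_j(y + a))] is nonnegative by induction. *)
Lemma abel_sum_le1 j y : 0 <= y -> abel_sum j y <= 1.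
Proof.
elim: j y => [|j IH] y y0; first by rewrite abel_sum0.
pose H t := expR (b * t) * (1 - abel_sum j.+1 t).
pose dH t := b * expR (b * t) * (1 - abel_sum j (t + a)).
have HdH (t : R) : is_derive t 1 H (dH t).
  have -> : H = (fun z => expR (b * z)) * (cst 1 - abel_sum j.+1) :> (R -> R).
    by apply/funext => z; rewrite /H !fctE.
  have dE := is_derive_expRM b t; have dS := is_derive_abel_sumS j t.
  apply: is_derive_eq; rewrite !fctE /= sub0r /GRing.scale /= /dH; ring.
have [u [u0 _]] := mean_value y0 HdH.
rewrite /H mulr0 expR0 abel_sumS_at0 subrr mulr0 !subr0 => E.
have : 0 <= expR (b * y) * (1 - abel_sum j.+1 y).
  rewrite E mulr_ge0// mulr_ge0 ?mulr_ge0 ?expR_ge0 ?(ltW b0)//.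
  by rewrite subr_ge0 IH// addr_ge0// ltW.
by rewrite pmulr_rge0 ?expR_gt0// subr_ge0.
Qed.

(** The derivative is [b] times the difference of two numbers in [[0, 1]]. *)
Lemma abel_sum_lip j y y' : 0 <= y -> 0 <= y' ->
  `|abel_sum j y - abel_sum j y'| <= b * `|y - y'|.
Proof.
wlog le_y : y y' / y' <= y => [H|] y0 y'0.
  have [/H|/ltW /H] := leP y' y; first exact.
  by rewrite distrC [X in _ -> _ <= b * X]distrC; exact.
case: j => [|j]; first by rewrite !abel_sum0 subrr normr0 mulr_ge0// ltW.
have [u [y'u _ ->]] := mean_value le_y (is_derive_abel_sumS j).
rewrite normrM ler_wpM2r// -mulrBr normrM gtr0_norm// ler_piMr ?(ltW b0)//.
have u0 := le_trans y'0 y'u.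
have ua0 : 0 <= u + a by rewrite addr_ge0// ltW.
have := abel_sum_le1 j ua0; have := abel_sum_le1 j.+1 u0.
have := abel_sum_ge0 j ua0; have := abel_sum_ge0 j.+1 u0.
by rewrite ler_norml; lra.
Qed.

(** The mean value theorem evaluates the derivative at some [u] with [|y - u| <= t]. Both of its
    terms are Lipschitz with constant [b ^ 2], so replacing [u] by [y] costs [2 b ^ 2 t]. *)
Lemma abel_sum_taylor j y t : 0 <= t -> t <= y ->
  `|abel_sum j.+1 (y - t) -
    (abel_sum j.+1 y - t * (b * abel_sum j (y + a) - b * abel_sum j.+1 y))|
  <= 2 * b ^+ 2 * t ^+ 2.
Proof.
move=> t0 ty.
have le_yt : y - t <= y by lra.
have [u [u1 u2 E]] := mean_value le_yt (is_derive_abel_sumS j).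
have -> : abel_sum j.+1 (y - t) -
    (abel_sum j.+1 y - t * (b * abel_sum j (y + a) - b * abel_sum j.+1 y)) =
    t * b * ((abel_sum j (y + a) - abel_sum j (u + a)) -
              (abel_sum j.+1 y - abel_sum j.+1 u)).
  have -> : abel_sum j.+1 (y - t) = abel_sum j.+1 y -
     (b * abel_sum j (u + a) - b * abel_sum j.+1 u) * t.
    by move: E; rewrite opprB addrCA subrr addr0 => <-; ring.
  ring.
rewrite normrM ger0_norm; last by rewrite mulr_ge0// ltW.
have -> : 2 * b ^+ 2 * t ^+ 2 = t * b * (2 * b * t) by ring.
rewrite ler_wpM2l// ?mulr_ge0 ?(ltW b0)//.
apply: le_trans (ler_normB _ _) _.
have y0 : 0 <= y by lra.
have u0 : 0 <= u by lra.
have uy : `|y - u| <= t by rewrite ger0_norm; lra.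
have H1 : `|abel_sum j (y + a) - abel_sum j (u + a)| <= b * t.
  apply: le_trans (abel_sum_lip _ _ _) _; rewrite ?addr_ge0 ?(ltW a0)//.
  by rewrite ler_wpM2l ?(ltW b0)// opprD addrACA subrr addr0.
have H2 : `|abel_sum j.+1 y - abel_sum j.+1 u| <= b * t.
  by apply: le_trans (abel_sum_lip _ _ _) _ => //; rewrite ler_wpM2l ?(ltW b0).
by lra.
Qed.

End abel_sums.

(** * The value function and its one-step error *)

Section drawdown_step.
Context {R : realType}.
Variables (p q a : R).
Hypotheses (p0 : 0 < p) (q0 : 0 < q) (a0 : 0 < a).

(** For [p = beta^+] and [q = - beta^-], the next three are the common denominator of [b_lambda] and
    [c_lambda], then [b_lambda] and [c_lambda]; positive parameters keep the signs visible. *)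
Definition exit_den : R := expR (q * a) - expR (- p * a).
Definition exit_b : R := (p * expR (q * a) + q * expR (- p * a)) / exit_den.
Definition exit_c : R := (p + q) / exit_den.
Local Notation den := exit_den.
Local Notation b := exit_b.
Local Notation c := exit_c.

Lemma exit_den_gt0 : 0 < den.
Proof.
rewrite subr_gt0 ltr_expR mulNr; apply: (@lt_trans _ _ 0).
  by rewrite oppr_lt0; apply: mulr_gt0.
by apply: mulr_gt0.
Qed.
Let den0 := exit_den_gt0.

Lemma exit_b_gt0 : 0 < b.
Proof. by rewrite divr_gt0// addr_gt0// mulr_gt0// expR_gt0. Qed.
Let b0 := exit_b_gt0.

Lemma exit_c_gt0 : 0 < c.
Proof. by rewrite divr_gt0// addr_gt0. Qed.
Let c0 := exit_c_gt0.

Definition total_weight (j : nat) : R := (c / b) ^+ j.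

Lemma total_weight_ge0 j : 0 <= total_weight j.
Proof. by rewrite exprn_ge0// divr_ge0// ltW. Qed.

Lemma total_weightS j : b * total_weight j.+1 = c * total_weight j.
Proof. by rewrite /total_weight exprS mulrA [b * _]mulrC divfK// gt_eqF. Qed.

Definition weight_bound n : R := (1 + c / b) ^+ n.

Lemma weight_bound_gt0 n : 0 < weight_bound n.
Proof. by rewrite exprn_gt0// addr_gt0// divr_gt0. Qed.

Lemma total_weight_le n j : (j <= n)%N -> total_weight j <= weight_bound n.
Proof.
move=> jn; have cb0 : 0 <= c / b by rewrite divr_ge0// ltW.
apply: (@le_trans _ _ (weight_bound j)).
  by rewrite lerXn2r ?nnegrE ?lerDr ?addr_ge0.
by rewrite ler_weXn2l// lerDl.
Qed.

(* [y] is the distance from the maximum of the current stage up to the target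
   level; [y < 0] means that the target has been exceeded. *)
Definition payoff_now (j : nat) (y : R) : R :=
  total_weight j * (if y < 0 then 1 else abel_sum a b j y).

(** The value when a drawdown completes: the new stage starts [a] below the old maximum, so the
    target is [a] further away unless it has been exceeded already. *)
Definition payoff_next (j : nat) (y : R) : R :=
  total_weight j * (if y < 0 then 1 else abel_sum a b j (y + a)).

(* The combination of [exp(- p e)] and [exp(q e)] equal to [X] at [e = 0] and to
   [Y] at [e = a]. *)
Definition interp (X Y e : R) : R :=
  ((expR (q * a) * X - Y) * expR (- p * e) +
   (Y - expR (- p * a) * X) * expR (q * e)) / den.

(** At [s.1 = 0] the predecessor is a default value. It is harmless, because the drawdown of a valid
    state is then [0], where [interp] does not depend on its second argument. *)
Definition state_value (s : nat * (R * R)) : R :=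
  interp (payoff_now s.1 s.2.1) (payoff_next s.1.-1 s.2.1) s.2.2.

(** [z] is the increment of the path. If [e < 0] the maximum rises by [- e]. If [a <= e] a new stage
    starts at the current position, [e] below the old maximum, overshoot included; a negative
    distance is then left unchanged, so that exceeding the target is never forgotten. With no
    drawdown left the state is frozen. *)
Definition move (s : nat * (R * R)) (z : R) : nat * (R * R) :=
  if s.1 == 0%N then s else
  let e := s.2.2 - z in
  if e < 0 then (s.1, (s.2.1 + e, 0))
  else if a <= e then (s.1.-1, (if s.2.1 < 0 then s.2.1 else s.2.1 + e, 0))
  else (s.1, (s.2.1, e)).

(** The potential with the drawdown replaced by an unconstrained [e]: at [e = D - z] it is the
    result of free evolution, with neither reflection nor reset. The factor [2] leaves a loss of at
    least [1] at a reset, where the exponential may jump up by at most [1]. *)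
Definition potential_ext (s : nat * (R * R)) (e : R) : R :=
  expR (- p * e) + 2 * s.1%:R + (0 <= s.2.1)%R%:R.

Definition potential (s : nat * (R * R)) : R := potential_ext s s.2.2.

Lemma interp0 X Y : interp X Y 0 = X.
Proof.
rewrite /interp !mulr0 expR0 !mulr1.
rewrite (_ : _ + _ = X * den); last by rewrite /den; ring.
by rewrite mulfK// gt_eqF.
Qed.

Lemma payoff_now_bounds n j y : (j <= n)%N ->
  0 <= payoff_now j y <= weight_bound n.
Proof.
move=> jn; rewrite /payoff_now; set u := if _ then _ else _.
have /andP[u0 u1] : 0 <= u <= 1.
  rewrite /u; case: ltP => y0; first by rewrite ler01 lexx.
  by rewrite abel_sum_ge0// abel_sum_le1.
rewrite mulr_ge0 ?total_weight_ge0//=; apply: le_trans (total_weight_le jn).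
by rewrite ler_piMr// total_weight_ge0.
Qed.

Lemma payoff_next_bounds n j y : (j <= n)%N ->
  0 <= payoff_next j y <= weight_bound n.
Proof.
move=> jn; rewrite /payoff_next; set u := if _ then _ else _.
have /andP[u0 u1] : 0 <= u <= 1.
  rewrite /u; case: ltP => y0; first by rewrite ler01 lexx.
  have ya : 0 <= y + a by rewrite addr_ge0// ltW.
  by rewrite abel_sum_ge0// abel_sum_le1.
rewrite mulr_ge0 ?total_weight_ge0//=; apply: le_trans (total_weight_le jn).
by rewrite ler_piMr// total_weight_ge0.
Qed.

Lemma interp_coefs M X Y : 0 <= X <= M -> 0 <= Y <= M ->
  `|(expR (q * a) * X - Y) / den| <= M * (expR (q * a) + 1) / den /\
  `|(Y - expR (- p * a) * X) / den| <= M * (expR (q * a) + 1) / den.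
Proof.
move=> /andP[X0 XM] /andP[Y0 YM].
have E1 : 1 <= expR (q * a) by rewrite -expR0 ler_expR mulr_ge0// ltW.
have E2 : expR (- p * a) <= 1.
  by rewrite -expR0 ler_expR mulNr oppr_le0 mulr_ge0// ltW.
have E3 := expR_ge0 (- p * a).
have H1 : expR (q * a) * X <= expR (q * a) * M by rewrite ler_wpM2l// expR_ge0.
have H2 : 0 <= expR (q * a) * X by rewrite mulr_ge0// expR_ge0.
have H3 : expR (- p * a) * X <= 1 * M by rewrite ler_pM.
have H4 : 0 <= expR (- p * a) * X by rewrite mulr_ge0.
have H5 : M <= expR (q * a) * M by rewrite ler_peMl//; lra.
by split; rewrite normrM (@gtr0_norm _ den^-1) ?invr_gt0// ler_wpM2r ?invr_ge0 ?(ltW den0)// ler_norml; lra.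
Qed.

Lemma interp_taylor0 M : exists2 C, 0 <= C & forall X Y t,
  0 <= X <= M -> 0 <= Y <= M -> 0 <= t <= 1 ->
  `|interp X Y (- t) - (X + t * (b * X - c * Y))| <= C * t ^+ 2.
Proof.
pose K := M * (expR (q * a) + 1) / den.
exists (`|K| * (p ^+ 2 * expR p + q ^+ 2 * expR q)).
  by rewrite mulr_ge0// addr_ge0// mulr_ge0 ?sqr_ge0 ?expR_ge0.
move=> X Y t XM YM /andP[t0 t1].
have [HA HB] := interp_coefs XM YM; rewrite -/K in HA HB.
set A := (_ / _) in HA; set B := (_ / _) in HB.
have -> : interp X Y (- t) - (X + t * (b * X - c * Y)) =
  A * (expR (p * t) - 1 - p * t) + B * (expR (- (q * t)) - 1 - (- (q * t))).
  have XE : X = A + B.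
    rewrite /A /B -mulrDl (_ : _ + _ = X * den) ?mulfK ?gt_eqF//.
    by rewrite /den; ring.
  have dE : b * X - c * Y = p * A - q * B by rewrite /A /B /b /c; ring.
  rewrite dE [in X in _ - X]XE /interp mulrNN [q * - t]mulrN mulrDl /A /B; ring.
have pt : `|p * t| <= p by rewrite ger0_norm ?mulr_ge0 ?(ltW p0)// ler_piMr// ltW.
have qt : `|- (q * t)| <= q.
  by rewrite normrN ger0_norm ?mulr_ge0 ?(ltW q0)// ler_piMr// ltW.
clearbody A B K.
apply: le_trans (ler_normD _ _) _; rewrite !normrM.
have H1 := expRB1B_le pt; have H2 := expRB1B_le qt.
apply: (@le_trans _ _ (`|K| * ((p * t) ^+ 2 * expR p) + `|K| * ((- (q * t)) ^+ 2 * expR q))).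
  rewrite lerD// ler_pM//.
    by rewrite (le_trans HA)// ler_norm.
  by rewrite (le_trans HB)// ler_norm.
by rewrite le_eqVlt; apply/orP; left; apply/eqP; ring.
Qed.

Lemma interp_near_a M : exists2 C, 0 <= C & forall X Y t,
  0 <= X <= M -> 0 <= Y <= M -> 0 <= t <= 1 ->
  `|interp X Y (a + t) - Y| <= C * t.
Proof.
pose K := M * (expR (q * a) + 1) / den.
exists (`|K| * (p * expR p + expR (q * a) * (q * expR q))).
  by rewrite mulr_ge0// addr_ge0// !mulr_ge0 ?expR_ge0// ltW.
move=> X Y t XM YM /andP[t0 t1].
have [HA HB] := interp_coefs XM YM; rewrite -/K in HA HB.
set A := (_ / _) in HA; set B := (_ / _) in HB.
have -> : interp X Y (a + t) - Y =
  A * expR (- p * a) * (expR (- (p * t)) - 1) + B * expR (q * a) * (expR (q * t) - 1).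
  rewrite /interp !mulrDr !expRD mulNr mulNr /A /B.
  have Ye : Y = Y * den / den by rewrite mulfK// gt_eqF.
  rewrite {3}Ye /den mulNr; ring.
have pt : `|- (p * t)| <= p.
  by rewrite normrN ger0_norm ?mulr_ge0 ?(ltW p0)// ler_piMr// ltW.
have qt : `|q * t| <= q by rewrite ger0_norm ?mulr_ge0 ?(ltW q0)// ler_piMr// ltW.
clearbody A B K.
apply: le_trans (ler_normD _ _) _; rewrite !normrM.
have H1 := expRB1_le pt; have H2 := expRB1_le qt.
rewrite !(ger0_norm (expR_ge0 _)).
have E2 : expR (- p * a) <= 1.
  by rewrite -expR0 ler_expR mulNr oppr_le0 mulr_ge0// ltW.
apply: (@le_trans _ _ (`|K| * 1 * (`|- (p * t)| * expR p) +
                       `|K| * expR (q * a) * (`|q * t| * expR q))).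
  rewrite lerD//.
    by rewrite ler_pM ?mulr_ge0 ?expR_ge0// ler_pM ?expR_ge0// (le_trans HA)// ler_norm.
  by rewrite ler_pM ?mulr_ge0 ?expR_ge0// ler_pM ?expR_ge0// (le_trans HB)// ler_norm.
have K0 : 0 <= K by apply: le_trans HA.
rewrite normrN !ger0_norm ?mulr_ge0 ?(ltW p0) ?(ltW q0)//.
by rewrite le_eqVlt; apply/orP; left; apply/eqP; ring.
Qed.

(** Meant for long steps, where [D - z] may lie far outside [[0, a]] and only exponential growth is
    controlled. *)
Lemma interp_bound M : exists2 C, 0 <= C & forall X Y D z,
  0 <= X <= M -> 0 <= Y <= M -> 0 <= D <= a ->
  `|interp X Y (D - z)| <= C * expR ((p + q) * `|z|).
Proof.
pose K := M * (expR (q * a) + 1) / den.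
exists (`|K| * (1 + expR (q * a))).
  by rewrite mulr_ge0// addr_ge0// expR_ge0.
move=> X Y D z XM YM /andP[D0 Da].
have [HA HB] := interp_coefs XM YM; rewrite -/K in HA HB.
set A := (_ / _) in HA; set B := (_ / _) in HB.
have -> : interp X Y (D - z) = A * expR (- p * (D - z)) + B * expR (q * (D - z)).
  by rewrite /interp /A /B; ring.
clearbody A B K.
apply: le_trans (ler_normD _ _) _; rewrite !normrM !(ger0_norm (expR_ge0 _)).
rewrite [`|K| * _]mulrDr mulr1 [X in _ <= X]mulrDl.
have z1 := ler_norm z; have z2 := ler_norm (- z); rewrite normrN in z2.
have pz : 0 <= p * `|z| by rewrite mulr_ge0// ltW.
have qz : 0 <= q * `|z| by rewrite mulr_ge0// ltW.
rewrite lerD//.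
  rewrite ler_pM ?expR_ge0 ?(le_trans HA) ?ler_norm// ler_expR.
  have : p * (z - D) <= p * `|z| by rewrite ler_wpM2l ?(ltW p0)//; lra.
  lra.
rewrite -mulrA -expRD ler_pM ?expR_ge0 ?(le_trans HB) ?ler_norm// ler_expR.
have : q * (D - z) <= q * (a + `|z|) by rewrite ler_wpM2l ?(ltW q0)//; lra.
lra.
Qed.

(** A rise by [- e] is paid by [exp (- p e) >= 1 - p e], a crossing of the target by the indicator,
    and a completed drawdown by the term [2 j]. *)
Lemma potential_drop s z : s.1 != 0%N -> 0 <= s.2.2 < a ->
  let e := s.2.2 - z in let s' := move s z in
  [/\ 0 <= potential_ext s e - potential s',
     e < 0 -> p * - e <= potential_ext s e - potential s',
     e < 0 -> 0 <= s.2.1 -> s.2.1 + e < 0 ->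
       1 <= potential_ext s e - potential s' &
     a <= e -> 1 <= potential_ext s e - potential s'].
Proof.
case: s => j [y D] /= j0 /andP[D0 Da]; rewrite /potential /potential_ext /move /=.
rewrite (negbTE j0); set e := D - z.
have e1 := expR_ge1Dx (- p * e).
case: (ltP e 0) => [elt0|ege0].
  have ae : (a <= e) = false by lra.
  rewrite ae /= mulr0 expR0.
  have pe : 0 <= - p * e by rewrite mulNr -mulrN mulr_ge0 ?oppr_ge0 ?ltW.
  have mono : ((0 <= y + e)%R%:R : R) <= (0 <= y)%R%:R.
    by case: (leP 0 (y + e)) => ye; case: (leP 0 y) => yy //; lra.
  split=> //; try lra.
  move=> _ y0 ye; rewrite y0 [(0 <= y + e)%R]leNgt ye /=; lra.
case: (leP a e) => [ae|ae] /=; last by split=> //; lra.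
rewrite mulr0 expR0.
have -> : ((0 <= (if y < 0 then y else y + e))%R%:R : R) = (0 <= y)%R%:R.
  case: (ltP y 0) => y0; first by rewrite leNgt y0.
  by rewrite addr_ge0.
have -> : j.-1%:R = j%:R - 1 :> R.
  by case: (j) j0 => // k _; rewrite -natr1 addrK.
have := expR_ge0 (- p * e).
by split=> //; lra.
Qed.

Lemma move_error_small n : exists2 C, 0 <= C & forall j y D z del,
  (0 < j)%N -> (j <= n)%N -> 0 <= D < a -> 0 < del <= 1 -> `|z| <= del ->
  `|state_value (move (j, (y, D)) z) -
    interp (payoff_now j y) (payoff_next j.-1 y) (D - z)| <=
  C * (del * (potential_ext (j, (y, D)) (D - z) - potential (move (j, (y, D)) z))).
Proof.
pose M := weight_bound n; have M0 : 0 < M := weight_bound_gt0 n.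
have [C1 C10 T1] := interp_taylor0 M; have [C2 C20 T2] := interp_near_a M.
(* The three sources of error: [C3] for a rise away from the target (second order), [C4] for a rise
   that crosses the target, [C5] for a completed drawdown (both first order). *)
pose C3 := C1 + 2 * b ^+ 2 * M; pose C4 := C1 + (2 * b + c) * M.
pose C5 := C2 + b * M.
have b0' := ltW b0; have c0' := ltW c0; have M0' := ltW M0.
have C30 : 0 <= C3 by rewrite addr_ge0// mulr_ge0// mulr_ge0// sqr_ge0.
have C40 : 0 <= C4 by rewrite addr_ge0// mulr_ge0// addr_ge0// mulr_ge0.
have C50 : 0 <= C5 by rewrite addr_ge0// mulr_ge0.
have C3p : 0 <= C3 / p by rewrite divr_ge0// ltW.
have Csum := addr_ge0 (addr_ge0 C3p C40) C50.
exists (C3 / p + C4 + C5) => //.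
move=> j y D z del j0 jn Da /andP[d0 d1] zd.
have jne : j != 0%N by rewrite -lt0n.
have jn' : (j.-1 <= n)%N by rewrite (leq_trans (leq_pred _)).
have [drop0 drop1 drop2 drop3] := @potential_drop (j, (y, D)) z jne Da.
set dpot := potential_ext _ _ - _ in drop0 drop1 drop2 drop3 *.
have XM := payoff_now_bounds y jn; have YM := payoff_next_bounds y jn'.
set X := payoff_now _ _ in XM *; set Y := payoff_next _ _ in YM *.
have Gj : b * total_weight j = c * total_weight j.-1.
  by case: (j) j0 => // k _; exact: total_weightS.
have Gj0 := total_weight_ge0 j; have GjM := total_weight_le jn.
have Gj'0 := total_weight_ge0 j.-1; have Gj'M := total_weight_le jn'.
rewrite -/M in GjM Gj'M.
have dd0 : 0 <= del * dpot by rewrite mulr_ge0// ltW.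
have Cdd (C' : R) (u : R) : 0 <= C' -> C' <= C3 / p + C4 + C5 -> u <= C' * (del * dpot) ->
    u <= (C3 / p + C4 + C5) * (del * dpot).
  by move=> C'0 C'C /le_trans; apply; rewrite ler_wpM2r.
have /andP[D0 Dlta] := Da.
move: zd; rewrite ler_norml => /andP[zd1 zd2].
rewrite /move /= (negbTE jne); rewrite /= in drop1 drop2 drop3.
case: ifPn => [elt0|]; last rewrite -leNgt => ege0.
  rewrite /state_value /= interp0.
  set t := - (D - z); have tE : D - z = - t by rewrite opprK.
  rewrite tE; have t0 : 0 < t by rewrite oppr_gt0.
  have td : t <= del by rewrite /t; lra.
  have t01 : 0 <= t <= 1 by apply/andP; split; lra.
  have H1 := T1 X Y t XM YM t01.
  have pdrop : p * t <= dpot by rewrite /t; exact: drop1.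
  (* A quadratic error is affordable: one factor [t] is at most [del], the other is paid by the
     potential. *)
  have t2 : t ^+ 2 <= (del * dpot) / p.
    rewrite ler_pdivlMr// expr2 -mulrA [t * p]mulrC; apply: ler_pM => //; first exact: ltW.
    by rewrite mulr_ge0// ltW.
  suff [H|H] : `|payoff_now j (y - t) - interp X Y (- t)| <= C3 * t ^+ 2 \/
     `|payoff_now j (y - t) - interp X Y (- t)| <= C4 * (del * dpot).
  - apply: (Cdd (C3 / p)) => //; first by rewrite -addrA lerDl addr_ge0.
    by apply: le_trans H _; rewrite -mulrA ler_wpM2l// mulrC.
  - by apply: (Cdd C4) => //; rewrite addrAC lerDr addr_ge0.
  case: (ltP y 0) => y0; last case: (ltP (y - t) 0) => yt.
  (* Target already exceeded: [X] and [Y] are pure weights with [b X = c Y], so the first-order term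
     vanishes. *)
  - left; have ytlt : y - t < 0 by lra.
    have C1t : C1 * t ^+ 2 <= C3 * t ^+ 2.
      by rewrite ler_wpM2r ?sqr_ge0// lerDl mulr_ge0// mulr_ge0// sqr_ge0.
    move: H1; rewrite /X /Y /payoff_now /payoff_next y0 ytlt !mulr1 Gj subrr mulr0 addr0.
    by rewrite distrC => /le_trans; apply.
  (* Crossing: [0 <= y <= t] and the Abel sum is [1] at [0], so [X] is within [M b t] of the value
     after crossing. *)
  - right; have S0 : abel_sum a b j 0 = 1.
      by case: (j) j0 => // k _; exact: abel_sumS_at0.
    have H2 : `|total_weight j - X| <= M * (b * t).
      rewrite /X /payoff_now ltNge y0 /= -{1}[total_weight j]mulr1 -mulrBr normrM.
      rewrite (ger0_norm Gj0) ler_pM// -S0.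
      apply: le_trans (abel_sum_lip a0 b0 _ (lexx 0) y0) _.
      by rewrite sub0r normrN ger0_norm// ler_wpM2l//; lra.
    have t2t : C1 * t ^+ 2 <= C1 * t by rewrite ler_wpM2l// expr2 ler_piMr//; lra.
    have /andP[bX0 bXM] : 0 <= b * X <= b * M.
      by case/andP: XM => ? ?; rewrite mulr_ge0//= ler_wpM2l.
    have /andP[cY0 cYM] : 0 <= c * Y <= c * M.
      by case/andP: YM => ? ?; rewrite mulr_ge0//= ler_wpM2l.
    have tl : t * (b * X - c * Y) <= t * (b * M).
      by apply: ler_wpM2l; [exact: ltW|rewrite lerBlDr (le_trans bXM)// lerDl].
    have tg : t * (- (c * M)) <= t * (b * X - c * Y).
      apply: ler_wpM2l; first exact: ltW.
      by rewrite lerBrDr addrC (@le_trans _ _ 0)// subr_le0.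
    have dp : 1 <= dpot by apply: drop2 => //; rewrite tE.
    have tdd : C4 * t <= C4 * (del * dpot).
      by rewrite ler_wpM2l// (le_trans td)// ler_peMr// ltW.
    apply: le_trans tdd; rewrite /C4.
    have tbM : 0 <= t * (b * M) by rewrite mulr_ge0 ?(ltW t0)// mulr_ge0.
    have tcM : 0 <= t * (c * M) by rewrite mulr_ge0 ?(ltW t0)// mulr_ge0.
    rewrite {1}/payoff_now yt mulr1.
    have -> : (C1 + (2 * b + c) * M) * t =
      C1 * t + M * (b * t) + t * (b * M) + t * (c * M) by ring.
    move: H1 H2; rewrite !ler_norml; lra.
  (* No crossing: the differential equation of the Abel sums cancels the first-order term of
     [interp]. *)
  - left; have H2 : `|payoff_now j (y - t) - (X + t * (b * X - c * Y))| <=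
        2 * b ^+ 2 * M * t ^+ 2.
      have yt' : t <= y by lra.
      case: (j) j0 Gj Gj0 GjM @X @Y {H1 XM YM drop0 drop1 drop2 drop3 dpot pdrop t2 dd0 Cdd} => // k _ Gk Gk0 GkM X Y /=.
      rewrite /X /Y /payoff_now /payoff_next !ltNge y0 yt /=.
      have := abel_sum_taylor a0 b0 k (ltW t0) yt'.
      move=> /(ler_wpM2l Gk0) H.
      have H' : total_weight k.+1 * (2 * b ^+ 2 * t ^+ 2) <= 2 * b ^+ 2 * M * t ^+ 2.
        rewrite mulrC [2 * b ^+ 2 * M * _]mulrAC ler_wpM2l// mulr_ge0 ?sqr_ge0//.
        by rewrite mulr_ge0// sqr_ge0.
      apply: le_trans (le_trans H H'); rewrite -[X in X * `|_|](ger0_norm Gk0) -normrM.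
      rewrite le_eqVlt; apply/orP; left; apply/eqP; congr (`|_|).
      rewrite [c * _]mulrA -Gk; ring.
    rewrite (_ : C3 * t ^+ 2 = C1 * t ^+ 2 + 2 * b ^+ 2 * M * t ^+ 2); last by rewrite /C3; ring.
    move: H1 H2; rewrite !ler_norml; lra.
case: ifPn => [ae|]; last first.
  (* Neither reflection nor reset: the new value is the interpolation itself. *)
  by rewrite -ltNge => ae; rewrite /state_value /= subrr normr0 mulr_ge0.
rewrite /state_value /= interp0.
apply: (Cdd C5) => //; first by rewrite lerDr addr_ge0.
(* The overshoot [t] both leaves the endpoint [a] of the interpolation and moves the target by
   [t]. *)
set t := D - z - a; have tE : D - z = a + t by rewrite /t; ring.
have t0 : 0 <= t by rewrite /t; lra.
have td : t <= del by rewrite /t; lra.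
have t01 : 0 <= t <= 1 by apply/andP; split; lra.
have H2 := T2 X Y t XM YM t01.
have drop := drop3 ae.
apply: (@le_trans _ _ (C5 * t)); last first.
  by rewrite ler_wpM2l// (le_trans td)// ler_peMr// ltW.
rewrite tE; have -> : C5 * t = C2 * t + M * (b * t) by rewrite /C5; ring.
have Mbt : 0 <= M * (b * t) by rewrite mulr_ge0// mulr_ge0.
suff H3 : `|payoff_now j.-1 (if y < 0 then y else y + (a + t)) - Y| <= M * (b * t).
  by move: H2 H3; rewrite !ler_norml; lra.
rewrite /Y /payoff_now /payoff_next; case: (ltP y 0) => y0.
  by rewrite y0 subrr normr0.
have ya : 0 <= y + a by rewrite addr_ge0// ltW.
have yat : 0 <= y + (a + t) by rewrite addrA addr_ge0.
rewrite ltNge yat /= -mulrBr normrM (ger0_norm Gj'0) ler_pM//.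
apply: le_trans (abel_sum_lip a0 b0 _ yat ya) _.
by rewrite ler_wpM2l// (_ : y + (a + t) - (y + a) = t) ?ger0_norm//; ring.
Qed.

Definition valid_state n (s : nat * (R * R)) : Prop :=
  [/\ (s.1 <= n)%N, 0 <= s.2.2, s.2.2 < a & s.1 = 0%N -> s.2.2 = 0].

Lemma valid_move n s z : valid_state n s -> valid_state n (move s z).
Proof.
case: s => j [y D] [/= jn D0 Da jD]; rewrite /move /=.
case: ifPn => [//|j0]; case: ifPn => [elt0|]; first by split=> //=.
rewrite -leNgt => e0; case: ifPn => [ae|]; last first.
  by rewrite -ltNge => ea; split => //= jz; rewrite jz in j0.
by split=> //=; rewrite (leq_trans (leq_pred _)).
Qed.

Lemma state_value_bound n : exists2 C, 0 <= C & forall s, valid_state n s ->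
  `|state_value s| <= C.
Proof.
pose M := weight_bound n; have [C C0 H] := interp_bound M.
exists C => // -[j [y D]] [/= jn D0 Da jD].
have jn' : (j.-1 <= n)%N by rewrite (leq_trans (leq_pred _)).
have Da' : 0 <= D <= a by rewrite D0 ltW.
have := H _ _ D 0 (payoff_now_bounds y jn) (payoff_next_bounds y jn') Da'.
by rewrite subr0 normr0 mulr0 expR0 mulr1.
Qed.

Lemma potential_bound n s : valid_state n s ->
  0 <= potential s <= 2 * n%:R + 2.
Proof.
case: s => j [y D] [/= jn D0 Da jD]; rewrite /potential /potential_ext /=.
have e1 : expR (- p * D) <= 1.
  by rewrite -expR0 ler_expR mulNr oppr_le0 mulr_ge0// ltW.
have e0 := expR_ge0 (- p * D).
have j0 : 0 <= j%:R :> R by [].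
have jn' : j%:R <= n%:R :> R by rewrite ler_nat.
by case: (0 <= y) => /=; apply/andP; split; lra.
Qed.

(** For [|z| > del] the crude exponential bound is multiplied by [exp (kap (|z| - del)) >= 1], and
    the exponential of [|z|] is replaced by the sum over both signs, which has an explicit Gaussian
    mean. *)
Lemma move_error n : exists2 C, 0 <= C & forall j y D z del kap,
  (0 < j)%N -> (j <= n)%N -> 0 <= D < a -> 0 < del <= 1 -> 0 <= kap ->
  `|state_value (move (j, (y, D)) z) -
    interp (payoff_now j y) (payoff_next j.-1 y) (D - z)| <=
  C * (del * (potential_ext (j, (y, D)) (D - z) - potential (move (j, (y, D)) z))
       + expR (- kap * del) *
         (expR ((p + q + kap) * z) + expR (- (p + q + kap) * z))).
Proof.
have [C1 C10 H1] := move_error_small n; have [C2 C20 H2] := state_value_bound n.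
have [C3 C30 H3] := interp_bound (weight_bound n).
exists (C1 + C2 + C3); first by rewrite !addr_ge0.
move=> j y D z del kap j0 jn Da /andP[d0 d1] kap0.
have jne : j != 0%N by rewrite -lt0n.
have jn' : (j.-1 <= n)%N by rewrite (leq_trans (leq_pred _)).
have [drop0 _ _ _] := @potential_drop (j, (y, D)) z jne Da.
have dd0 := mulr_ge0 (ltW d0) drop0.
set ddrop := del * _ in dd0 *.
have ee0 : 0 <= expR (- kap * del) *
         (expR ((p + q + kap) * z) + expR (- (p + q + kap) * z)).
  by rewrite mulr_ge0 ?expR_ge0// addr_ge0 ?expR_ge0.
set ee := expR (- kap * del) * _ in ee0 *.
have [zd|zd] := leP `|z| del.
  apply: le_trans (H1 j y D z del j0 jn Da _ zd) _; first by rewrite d0.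
  by rewrite ler_pM// ?lerDl// -addrA lerDl addr_ge0.
have /andP[D0 Dlta] := Da.
have vs : valid_state n (move (j, (y, D)) z).
  by apply: valid_move; split=> //= jz; rewrite jz in jne.
have Da' : 0 <= D <= a by rewrite D0 ltW.
have := H3 _ _ D z (payoff_now_bounds y jn) (payoff_next_bounds y jn') Da'.
have := H2 _ vs.
set u := state_value _; set v := interp _ _ _ => Hu Hv.
have pq : 0 <= p + q by rewrite addr_ge0// ltW.
have E1 : 1 <= expR ((p + q) * `|z|) by rewrite -expR0 ler_expR mulr_ge0.
have E2 : expR ((p + q) * `|z|) <= ee.
  apply: (@le_trans _ _ (expR (- kap * del) * expR ((p + q + kap) * `|z|))).
    rewrite -expRD ler_expR.
    have : kap * del <= kap * `|z| by rewrite ler_wpM2l// ltW.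
    by lra.
  rewrite ler_wpM2l ?expR_ge0//; have [z0|z0] := leP 0 z.
    by rewrite ger0_norm// lerDl expR_ge0.
  by rewrite ltr0_norm// mulrN mulNr lerDr expR_ge0.
have F1 : C2 <= C2 * ee by rewrite ler_peMr// (le_trans E1).
have F2 : C3 * expR ((p + q) * `|z|) <= C3 * ee by rewrite ler_wpM2l.
apply: le_trans (ler_normB _ _) _.
apply: (@le_trans _ _ ((C2 + C3) * ee)); first by rewrite mulrDl; lra.
rewrite ler_pM ?addr_ge0//; last by rewrite lerDr.
by rewrite -addrA lerDr.
Qed.

End drawdown_step.

(** * Expected payoff of the Gaussian chain *)

(** A preimage splits into countably many pieces on which [k] is constant, so discrete coordinates
    may be frozen in measurability proofs. *)
Lemma measurable_fun_nat_param d1 d2 (T : measurableType d1)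
    (U : measurableType d2) (k : T -> nat) (f : nat -> T -> U) :
  measurable_fun setT k -> (forall j, measurable_fun setT (f j)) ->
  measurable_fun setT (fun t => f (k t) t).
Proof.
move=> mk mf _ B mB; rewrite setTI.
have -> : (fun t => f (k t) t) @^-1` B =
    \bigcup_j ((k @^-1` [set j]) `&` (f j @^-1` B)).
  apply/seteqP; split => [t Bt|t [j _ [/= <-]]//].
  by exists (k t).
apply: bigcupT_measurable => j; apply: measurableI.
  by rewrite -[X in measurable X]setTI; exact: mk.
by rewrite -[X in measurable X]setTI; exact: mf.
Qed.

Section exponential_moments.
Context {R : realType}.
Variables (m s r : R).
Hypothesis r0 : r != 0.
Local Notation nu := (normal_prob 0 r).

Let moment (t : R) : R := expR (t * m + (t * s) ^+ 2 * r ^+ 2 / 2).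

Lemma integrable_exp_affine (k t : R) :
  nu.-integrable setT (fun w => (k * expR (t * (m + s * w)))%:E).
Proof.
under eq_fun do rewrite mulrDr expRD mulrA EFinM (mulrA t).
by apply: integrableZl => //; exact: integrable_normal_expR.
Qed.

Lemma integral_exp_affine (k t : R) :
  (\int[nu]_w (k * expR (t * (m + s * w)))%:E = (k * moment t)%:E)%E.
Proof.
under eq_integral do rewrite mulrDr expRD mulrA EFinM (mulrA t).
rewrite integralZl//; last exact: integrable_normal_expR.
by rewrite integral_normal_expR// -EFinM /moment expRD mulrA.
Qed.

(** The shape of the majorant in [lyapunov_drift]: a constant, the two eigenfunctions, and the two
    signs of the bound for long steps. *)
Lemma integral_exp_combination (k0 k1 k2 k3 k4 t1 t2 t3 t4 : R) :
  let f w := k0 + (k1 * expR (t1 * (m + s * w)) + (k2 * expR (t2 * (m + s * w)) +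
    (k3 * expR (t3 * (m + s * w)) + k4 * expR (t4 * (m + s * w))))) in
  nu.-integrable setT (EFin \o f) /\
  (\int[nu]_w (f w)%:E = (k0 + (k1 * moment t1 + (k2 * moment t2 +
      (k3 * moment t3 + k4 * moment t4))))%:E)%E.
Proof.
have I := integrable_exp_affine.
have J := integral_exp_affine.
have ID (f g : measurableTypeR R -> R) (u v : R) :
    nu.-integrable setT (EFin \o f) /\ (\int[nu]_w (f w)%:E = u%:E)%E ->
    nu.-integrable setT (EFin \o g) /\ (\int[nu]_w (g w)%:E = v%:E)%E ->
    nu.-integrable setT (EFin \o (fun w => f w + g w)) /\
    (\int[nu]_w (f w + g w)%:E = (u + v)%:E)%E.
  move=> [If Ef] [Ig Eg]; split.
    exact: (eq_integrable measurableT _ _ _ (integrableD measurableT If Ig)).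
  under eq_integral do rewrite EFinD.
  by rewrite integralD// Ef Eg.
have C : nu.-integrable setT (EFin \o (fun=> k0)) /\
    (\int[nu]_w (k0%:E : \bar R) = k0%:E)%E.
  split; first exact: finite_measure_integrable_cst.
  by rewrite integral_cst//= probability_setT mule1.
have T k t : nu.-integrable setT (EFin \o (fun w => k * expR (t * (m + s * w)))) /\
    (\int[nu]_w (k * expR (t * (m + s * w)))%:E = (k * moment t)%:E)%E.
  by split; [exact: I|exact: J].
exact: ID C (ID _ _ _ _ (T _ _) (ID _ _ _ _ (T _ _) (ID _ _ _ _ (T _ _) (T _ _)))).
Qed.
End exponential_moments.

(** * The discounted walk and its measurability *)

Section walk.
Context {R : realType}.
Variables (p q a mu sigma lam : R).
Hypotheses (p0 : 0 < p) (q0 : 0 < q) (a0 : 0 < a) (lam0 : 0 < lam).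
Hypothesis pE : p * mu + (p * sigma) ^+ 2 / 2 = lam.
Hypothesis qE : - q * mu + (- q * sigma) ^+ 2 / 2 = lam.
Local Notation b := (exit_b p q a).

(* A state is [(discount, (drawdowns left, (distance to the target, drawdown)))]. *)
Local Notation state := (R * (nat * (R * R)))%type.
Local Notation mstate := (measurableTypeR R * (nat * (measurableTypeR R * measurableTypeR R)))%type.

Definition walk_step (h : R) (x : state * R) : state :=
  ((if x.1.2.1 == 0%N then x.1.1 else x.1.1 * expR (- lam * h)),
   move a x.1.2 (mu * h + sigma * x.2)).

Lemma measurable_walk_step h :
  measurable_fun [set: mstate * measurableTypeR R] (walk_step h : _ -> mstate).
Proof.
have m1 : measurable_fun [set: mstate * measurableTypeR R] (fun x => x.1.1).
  exact: measurableT_comp measurable_fst measurable_fst.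
have m2 : measurable_fun [set: mstate * measurableTypeR R] (fun x => x.1.2).
  exact: measurableT_comp measurable_snd measurable_fst.
have mj : measurable_fun [set: mstate * measurableTypeR R] (fun x => x.1.2.1).
  exact: measurableT_comp measurable_fst m2.
have m22 : measurable_fun [set: mstate * measurableTypeR R] (fun x => x.1.2.2).
  exact: measurableT_comp measurable_snd m2.
have my : measurable_fun [set: mstate * measurableTypeR R] (fun x => x.1.2.2.1).
  exact: measurableT_comp measurable_fst m22.
have mD : measurable_fun [set: mstate * measurableTypeR R] (fun x => x.1.2.2.2).
  exact: measurableT_comp measurable_snd m22.
have mz : measurable_fun [set: mstate * measurableTypeR R]
    (fun x => mu * h + sigma * x.2 : measurableTypeR R).
  apply: measurable_funD; first exact: measurable_cst.
  apply: measurable_funM; first exact: measurable_cst.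
  exact: measurable_snd.
have me := measurable_funB mD mz.
have mye := measurable_funD my me.
apply: measurable_fun_pair.
  apply: (@measurable_fun_nat_param _ _ _ _ (fun x : mstate * measurableTypeR R => x.1.2.1)
    (fun j x => if j == 0%N then x.1.1 else x.1.1 * expR (- lam * h))) => // j.
  by case: (j == 0%N) => //; apply: measurable_funM => //; exact: measurable_cst.
have E : (fun x : mstate * measurableTypeR R => move a x.1.2 (mu * h + sigma * x.2)) =
    (fun x => move a (x.1.2.1, x.1.2.2) (mu * h + sigma * x.2)).
  by apply/funext => -[[? []]].
rewrite E.
apply: (@measurable_fun_nat_param _ _ _ _ (fun x : mstate * measurableTypeR R => x.1.2.1)
    (fun j x => move a (j, x.1.2.2) (mu * h + sigma * x.2)
       : (nat * (measurableTypeR R * measurableTypeR R))%type)) => // j.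
rewrite /move /=; case: (j == 0%N).
  by apply: measurable_fun_pair => //; exact: measurable_cst.
apply: measurable_fun_ifT.
- exact: measurable_fun_ltr.
- apply: measurable_fun_pair; first exact: measurable_cst.
  by apply: measurable_fun_pair => //; exact: measurable_cst.
- apply: measurable_fun_ifT.
  + exact: measurable_fun_ler.
  + apply: measurable_fun_pair; first exact: measurable_cst.
    apply: measurable_fun_pair; last exact: measurable_cst.
    by apply: measurable_fun_ifT => //; exact: measurable_fun_ltr.
  + apply: measurable_fun_pair; first exact: measurable_cst.
    exact: measurable_fun_pair.
Qed.

Lemma measurable_abel_sum j :
  measurable_fun [set: measurableTypeR R] (abel_sum a b j : _ -> measurableTypeR R).
Proof.
apply: continuous_measurable_fun; case: j => [|j].
  rewrite (_ : abel_sum a b 0 = cst 0); first by move=> ?; exact: cvg_cst.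
  by apply/funext => y; exact: abel_sum0.
exact/is_derive_continuous/is_derive_abel_sumS.
Qed.

Lemma measurable_state_value :
  measurable_fun [set: (nat * (measurableTypeR R * measurableTypeR R))%type]
    (state_value p q a : _ -> measurableTypeR R).
Proof.
set T := (nat * (measurableTypeR R * measurableTypeR R))%type.
have mj : measurable_fun [set: T] (fun x => x.1) by exact: measurable_fst.
have m2 : measurable_fun [set: T] (fun x => x.2) by exact: measurable_snd.
have my : measurable_fun [set: T] (fun x => x.2.1).
  exact: measurableT_comp measurable_fst m2.
have mD : measurable_fun [set: T] (fun x => x.2.2).
  exact: measurableT_comp measurable_snd m2.
have cM (k : R) (f : T -> measurableTypeR R) : measurable_fun setT f ->
    measurable_fun setT (fun x => k * f x : measurableTypeR R).
  by move=> mf; apply: measurable_funM => //; exact: measurable_cst.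
have mexp (k : R) : measurable_fun [set: T] (fun x => expR (k * x.2.2) : measurableTypeR R).
  by apply: measurableT_comp; [exact: measurable_expR|exact: cM].
have mlt : measurable_fun [set: T] (fun x => x.2.1 < 0).
  by apply: measurable_fun_ltr => //; exact: measurable_cst.
apply: (@measurable_fun_nat_param _ _ _ _ (fun x : T => x.1)
    (fun j x => interp p q a (payoff_now p q a j x.2.1)
       (payoff_next p q a j.-1 x.2.1) x.2.2 : measurableTypeR R)) => // j.
have mX : measurable_fun [set: T] (fun x => payoff_now p q a j x.2.1 : measurableTypeR R).
  apply: cM; apply: measurable_fun_ifT => //.
  exact: (measurableT_comp (measurable_abel_sum j) my).
have mY : measurable_fun [set: T] (fun x => payoff_next p q a j.-1 x.2.1 : measurableTypeR R).
  apply: cM; apply: measurable_fun_ifT => //.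
  apply: (measurableT_comp (measurable_abel_sum j.-1)).
  by apply: measurable_funD => //; exact: measurable_cst.
apply: measurable_funM; last exact: measurable_cst.
apply: measurable_funD; (apply: measurable_funM; last exact: mexp).
  by apply: measurable_funB => //; exact: cM.
by apply: measurable_funB => //; exact: cM.
Qed.

Lemma measurable_potential :
  measurable_fun [set: (nat * (measurableTypeR R * measurableTypeR R))%type]
    (potential p : _ -> measurableTypeR R).
Proof.
set T := (nat * (measurableTypeR R * measurableTypeR R))%type.
have mj : measurable_fun [set: T] (fun x => x.1) by exact: measurable_fst.
have m2 : measurable_fun [set: T] (fun x => x.2) by exact: measurable_snd.
have my : measurable_fun [set: T] (fun x => x.2.1).
  exact: measurableT_comp measurable_fst m2.
have mD : measurable_fun [set: T] (fun x => x.2.2).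
  exact: measurableT_comp measurable_snd m2.
apply: (@measurable_fun_nat_param _ _ _ _ (fun x : T => x.1)
    (fun j x => expR (- p * x.2.2) + 2 * j%:R + (0 <= x.2.1)%R%:R : measurableTypeR R)) => // j.
apply: measurable_funD.
  apply: measurable_funD; last exact: measurable_cst.
  apply: measurableT_comp; first exact: measurable_expR.
  by apply: measurable_funM => //; exact: measurable_cst.
rewrite (_ : (fun x : T => (0 <= x.2.1)%R%:R : R) = (fun x => if 0 <= x.2.1 then 1 else 0)).
  apply: measurable_fun_ifT; [|exact: measurable_cst..].
  by apply: measurable_fun_ler => //; exact: measurable_cst.
by apply/funext => x; case: ifP.
Qed.

End walk.

(** * One-step drift of the corrected value function *)

Section walk_bound.
Context {R : realType}.
Variables (p q a mu sigma lam : R).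
Hypotheses (p0 : 0 < p) (q0 : 0 < q) (a0 : 0 < a) (lam0 : 0 < lam).
Hypothesis pE : p * mu + (p * sigma) ^+ 2 / 2 = lam.
Hypothesis qE : - q * mu + (- q * sigma) ^+ 2 / 2 = lam.
Local Notation b := (exit_b p q a).
Local Notation state := (R * (nat * (R * R)))%type.
Local Notation mstate := (measurableTypeR R * (nat * (measurableTypeR R * measurableTypeR R)))%type.
Local Notation walk_step := (walk_step a mu sigma lam).
Local Notation state_value := (state_value p q a).
Local Notation potential := (potential p).

(** Boolean, so that it can cut off [lyapunov], which has to be measurable and bounded on all
    states, reachable or not. *)
Definition admissible n (s : state) : bool :=
  [&& 0 <= s.1, s.1 <= 1, (s.2.1 <= n)%N, 0 <= s.2.2.2, s.2.2.2 < a &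
      (s.2.1 == 0%N) ==> (s.2.2.2 == 0)].

Lemma admissibleP n s : reflect (0 <= s.1 <= 1 /\ valid_state a n s.2) (admissible n s).
Proof.
apply: (iffP idP) => [/and5P[d0 d1 jn D0 /andP[Da jD]]|[/andP[d0 d1] [jn D0 Da jD]]].
  split; first by rewrite d0.
  by split=> // /eqP jz; apply/eqP; exact: (implyP jD).
by rewrite /admissible d0 d1 jn D0 Da /=; apply/implyP => /eqP /jD ->.
Qed.

Lemma admissible_step n h s w : 0 <= h -> admissible n s ->
  admissible n (walk_step h (s, w)).
Proof.
move=> h0 /admissibleP[/andP[d0 d1] vs]; apply/admissibleP; split; last exact: valid_move.
rewrite /walk_step /=; case: ifP => _; first by rewrite d0.
rewrite mulr_ge0 ?expR_ge0//= (le_trans _ d1)// ler_piMr//.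
by rewrite -expR0 ler_expR mulNr oppr_le0 mulr_ge0// ltW.
Qed.

(* [eps] is [1] or [-1]: the two signs give the two one-sided estimates. *)
Definition lyapunov (n : nat) (eps K : R) (s : state) : R :=
  if admissible n s then s.1 * (eps * state_value s.2 + K * potential s.2) else 0.

Lemma measurable_lyapunov n eps K :
  measurable_fun [set: mstate] (lyapunov n eps K : _ -> measurableTypeR R).
Proof.
have md : measurable_fun [set: mstate] (fun x => x.1) by exact: measurable_fst.
have m2 : measurable_fun [set: mstate] (fun x => x.2) by exact: measurable_snd.
have mj : measurable_fun [set: mstate] (fun x => x.2.1).
  exact: measurableT_comp measurable_fst m2.
have m22 : measurable_fun [set: mstate] (fun x => x.2.2).
  exact: measurableT_comp measurable_snd m2.
have mD : measurable_fun [set: mstate] (fun x => x.2.2.2).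
  exact: measurableT_comp measurable_snd m22.
apply: measurable_fun_ifT.
- apply: measurable_and; first by apply: measurable_fun_ler => //; exact: measurable_cst.
  apply: measurable_and; first by apply: measurable_fun_ler => //; exact: measurable_cst.
  apply: (@measurable_fun_nat_param _ _ _ _ (fun x : mstate => x.2.1)
    (fun j x => [&& (j <= n)%N, 0 <= x.2.2.2, x.2.2.2 < a &
      (j == 0%N) ==> (x.2.2.2 == 0)])) => // j.
  apply: measurable_and; first exact: measurable_cst.
  apply: measurable_and; first by apply: measurable_fun_ler => //; exact: measurable_cst.
  apply: measurable_and; first by apply: measurable_fun_ltr => //; exact: measurable_cst.
  case: (j == 0%N) => /=; last exact: measurable_cst.
  by apply: measurable_fun_eqr => //; exact: measurable_cst.
- apply: measurable_funM => //; apply: measurable_funD.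
  + apply: measurable_funM; first exact: measurable_cst.
    exact: (measurableT_comp (measurable_state_value p q a) m2).
  + apply: measurable_funM; first exact: measurable_cst.
    exact: (measurableT_comp (measurable_potential p) m2).
- exact: measurable_cst.
Qed.

Lemma lyapunov_bound n eps K : exists C, forall s, `|lyapunov n eps K s| <= C.
Proof.
have [C C0 H] := state_value_bound p0 q0 a0 n.
exists (`|eps| * C + `|K| * (2 * n%:R + 2)) => s; rewrite /lyapunov.
case: ifPn => [/admissibleP[/andP[d0 d1] vs]|_]; last first.
  by rewrite normr0 addr_ge0// mulr_ge0// addr_ge0// mulr_ge0.
rewrite normrM ger0_norm//; apply: le_trans (ler_wpM2r (normr_ge0 _) d1) _.
rewrite mul1r; apply: le_trans (ler_normD _ _) _; rewrite (normrM eps) (normrM K) lerD//.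
  by rewrite ler_wpM2l//; exact: H.
rewrite ler_wpM2l//.
by have /andP[u0 u1] := potential_bound p0 vs; rewrite ger0_norm.
Qed.

Let moment_bound th h : 0 <= th -> 0 < h ->
  expR (th * (mu * h) + (th * sigma) ^+ 2 * Num.sqrt h ^+ 2 / 2) +
  expR (- th * (mu * h) + (- th * sigma) ^+ 2 * Num.sqrt h ^+ 2 / 2) <=
  2 * expR (h * (th * `|mu| + (th * sigma) ^+ 2 / 2)).
Proof.
move=> th0 h0; rewrite sqr_sqrtr ?(ltW h0)//.
have thh : 0 <= th * h by rewrite mulr_ge0// ltW.
have m1 := ler_wpM2l thh (ler_norm mu).
have m2 := ler_wpM2l thh (ler_norm (- mu)); rewrite normrN in m2.
rewrite [2 * _]mulr_natl mulr2n lerD// ler_expR; lra.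
Qed.

(** The multiple [C del] of the potential absorbs the part of [move_error] charged to its loss. What
    remains is a combination of exponentials: discounting exactly undoes the growth of the
    eigenfunctions, and only the term for long steps is left over. *)
Lemma lyapunov_drift n : exists2 C, 0 <= C & forall h del kap eps,
  0 < h -> 0 < del <= 1 -> 0 <= kap -> `|eps| = 1 -> forall s, admissible n s ->
  (\int[normal_prob 0 (Num.sqrt h)]_w
     (lyapunov n eps (C * del) (walk_step h (s, w)))%:E <=
   (lyapunov n eps (C * del) s + C * expR (- kap * del) *
      (2 * expR (h * ((p + q + kap) * `|mu| +
                      ((p + q + kap) * sigma) ^+ 2 / 2))))%:E)%E.
Proof.
have [C C0 H] := move_error p0 q0 a0 n; exists C => //.
move=> h del kap eps h0 del01 kap0 eps1 s adm.
have /andP[del0 del1] := del01.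
set th := p + q + kap; have th0 : 0 <= th by rewrite !addr_ge0// ltW.
set rho := C * expR _ * _.
have rho0 : 0 <= rho by rewrite !mulr_ge0 ?expR_ge0.
have sh : Num.sqrt h != 0 by rewrite gt_eqF// sqrtr_gt0.
case: s adm => d [[|j] [y D]] adm.
  rewrite (_ : (fun w => _) = cst (lyapunov n eps (C * del) (d, (0%N, (y, D))))%:E)//.
  by rewrite integral_cst//= probability_setT mule1 lee_fin lerDl.
pose z (w : R) := mu * h + sigma * w.
have /admissibleP[/andP[/= d0 d1] [/= jn D0 Da _]] := adm.
pose X := payoff_now p q a j.+1 y; pose Y := payoff_next p q a j y.
pose A := (expR (q * a) * X - Y) / exit_den p q a.
pose B := (Y - expR (- p * a) * X) / exit_den p q a.
pose d' := d * expR (- lam * h).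
pose y01 : R := (0 <= y)%R%:R.
(* Free evolution of the corrected value, split by exponent, plus the bound for long steps. *)
pose g w : R := d' * (C * del) * (2 * j.+1%:R + y01) +
  (d' * expR (- p * D) * (eps * A + C * del) * expR (p * z w) +
  (d' * expR (q * D) * (eps * B) * expR (- q * z w) +
  (d' * (C * expR (- kap * del)) * expR (th * z w) +
   d' * (C * expR (- kap * del)) * expR (- th * z w)))).
have d'0 : 0 <= d' by rewrite mulr_ge0// expR_ge0.
have le_g w : lyapunov n eps (C * del) (walk_step h ((d, (j.+1, (y, D))), w)) <= g w.
  have adm' := admissible_step w (ltW h0) adm.
  rewrite /lyapunov adm' /walk_step /= -/(z w) -/d'.
  have D0a : 0 <= D < a by rewrite D0.
  have := H j.+1 y D (z w) del kap isT jn D0a del01 kap0.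
  rewrite -/th [payoff_next p q a _ y]/= -/X -/Y.
  set V := state_value _; set Q := potential _.
  move=> HV.
  have HV' : eps * (V - interp p q a X Y (D - z w)) <=
      `|V - interp p q a X Y (D - z w)|.
    by apply: le_trans (ler_norm _) _; rewrite normrM eps1 mul1r.
  have gE : g w = d' * (eps * interp p q a X Y (D - z w) +
     C * del * potential_ext p (j.+1, (y, D)) (D - z w) +
     C * (expR (- kap * del) * (expR (th * z w) + expR (- th * z w)))).
    rewrite /g /potential_ext /interp /= -/y01.
    have E1 : expR (- p * (D - z w)) = expR (- p * D) * expR (p * z w).
      by rewrite -expRD; congr expR; ring.
    have E2 : expR (q * (D - z w)) = expR (q * D) * expR (- q * z w).
      by rewrite -expRD; congr expR; ring.
    rewrite E1 E2 /A /B; ring.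
  rewrite gE ler_wpM2l//.
  move: (le_trans HV' HV).
  set ee := expR (- kap * del) * _; set pe := potential_ext _ _ _; lra.
have [C' HC'] := lyapunov_bound n eps (C * del).
have [int_g Eg] := integral_exp_combination (mu * h) sigma sh
  (d' * (C * del) * (2 * j.+1%:R + y01))
  (d' * expR (- p * D) * (eps * A + C * del))
  (d' * expR (q * D) * (eps * B))
  (d' * (C * expR (- kap * del))) (d' * (C * expR (- kap * del)))
  p (- q) th (- th).
have mstep1 : measurable_fun [set: measurableTypeR R]
    (fun w => lyapunov n eps (C * del) (walk_step h ((d, (j.+1, (y, D))), w)) : measurableTypeR R).
  apply: (measurableT_comp (measurable_lyapunov n eps (C * del))).
  have := measurable_walk_step a mu sigma lam h.
  move=> /measurable_fun_pair2; exact.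
apply: (@le_trans _ _ (\int[normal_prob 0 (Num.sqrt h)]_w (g w)%:E)%E).
  apply: le_integral => //.
    by apply: (@bounded_integrable _ _ _ _ _ C').
  by move=> w _; rewrite lee_fin; exact: le_g.
rewrite Eg lee_fin sqr_sqrtr ?(ltW h0)//.
have Ep : expR (p * (mu * h) + (p * sigma) ^+ 2 * h / 2) = expR (lam * h).
  by rewrite -pE; congr expR; ring.
have Eq : expR (- q * (mu * h) + (- q * sigma) ^+ 2 * h / 2) = expR (lam * h).
  by rewrite -qE; congr expR; ring.
rewrite Ep Eq.
have := moment_bound th0 h0; rewrite sqr_sqrtr ?(ltW h0)//.
set Th1 := expR (th * _ + _); set Th2 := expR (- th * _ + _) => Hth.
have d'1 : d' <= d.
  by rewrite ler_piMr// -expR0 ler_expR mulNr oppr_le0 mulr_ge0// ltW.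
have dE : d' * expR (lam * h) = d.
  by rewrite /d' -mulrA -expRD mulNr addNr expR0 mulr1.
(* The part [2 j] and the indicator do not grow under free evolution, so discounting only lowers
   them. *)
have T1 : d' * (C * del) * (2 * j.+1%:R + y01) <= d * (C * del) * (2 * j.+1%:R + y01).
  have y010 : 0 <= y01 by rewrite /y01; case: (0 <= y).
  have Cd : 0 <= C * del by rewrite mulr_ge0// ltW.
  by rewrite ler_wpM2r ?addr_ge0// ler_wpM2r.
have T2 : d' * (C * expR (- kap * del)) * (Th1 + Th2) <= rho.
  rewrite /rho; apply: ler_pM => //.
  - by rewrite mulr_ge0// mulr_ge0// expR_ge0.
  - by rewrite addr_ge0// expR_ge0.
  - by rewrite ler_piMl ?mulr_ge0 ?expR_ge0// (le_trans d'1).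
rewrite /lyapunov adm /= /state_value /potential /potential_ext /= -/X -/Y -/y01.
have -> : interp p q a X Y D = A * expR (- p * D) + B * expR (q * D).
  by rewrite /interp /A /B; ring.
have -> : d' * expR (- p * D) * (eps * A + C * del) * expR (lam * h) =
   d * (expR (- p * D) * (eps * A + C * del)) by rewrite -dE; ring.
have -> : d' * expR (q * D) * (eps * B) * expR (lam * h) =
   d * (expR (q * D) * (eps * B)) by rewrite -dE; ring.
move: T1 T2; set eD := expR (- p * D); set eq' := expR (q * D).
set K := C * expR _; set JJ := 2 * j.+1%:R.
move=> T1 T2.
have := lerD T1 T2; lra.
Qed.

End walk_bound.

(** * Mean payoff at a finite horizon *)

Section walk_payoff.
Context {R : realType}.
Variables (p q a mu sigma lam : R).
Hypotheses (p0 : 0 < p) (q0 : 0 < q) (a0 : 0 < a) (lam0 : 0 < lam).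
Hypothesis pE : p * mu + (p * sigma) ^+ 2 / 2 = lam.
Hypothesis qE : - q * mu + (- q * sigma) ^+ 2 / 2 = lam.
Local Notation state := (R * (nat * (R * R)))%type.
Local Notation mstate := (measurableTypeR R * (nat * (measurableTypeR R * measurableTypeR R)))%type.

Definition walk (T : Type) (h : R) (xi : nat -> T -> R) (n : nat) (y : R) (k : nat) (w : T) : state :=
  chain xi (walk_step a mu sigma lam h) (1, (n, (y, 0))) k w.

Definition walk_payoff (s : state) : R :=
  if (s.2.1 == 0%N) && (s.2.2.1 < 0) then s.1 else 0.

Lemma walk_discount (T : Type) h (xi : nat -> T -> R) n y k w :
  (walk h xi n y k w).2.1 != 0%N ->
  (walk h xi n y k w).1 = expR (- lam * h * k%:R).
Proof.
elim: k => [|k IH] /=; first by rewrite mulr0 expR0.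
rewrite /walk /= -/(walk h xi n y k w); set s := walk _ _ _ _ _ _ in IH *.
rewrite /walk_step /= /move /=; case: ifPn => [s0|s0 _].
  by rewrite s0.
by rewrite IH// -expRD -natr1; congr expR; ring.
Qed.

Lemma walk_admissible (T : Type) h (xi : nat -> T -> R) n y k w : 0 < h ->
  admissible a n (walk h xi n y k w).
Proof.
move=> h0; elim: k => [|k IH] /=; last exact: (admissible_step mu sigma a0 lam0 _ (ltW h0) IH).
apply/admissibleP; split; first by rewrite ler01 lexx.
by split=> //=.
Qed.

Lemma measurable_walk_payoff :
  measurable_fun [set: mstate] (walk_payoff : _ -> measurableTypeR R).
Proof.
have md : measurable_fun [set: mstate] (fun x => x.1) by exact: measurable_fst.
have m2 : measurable_fun [set: mstate] (fun x => x.2) by exact: measurable_snd.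
have mj : measurable_fun [set: mstate] (fun x => x.2.1).
  exact: measurableT_comp measurable_fst m2.
have m22 : measurable_fun [set: mstate] (fun x => x.2.2).
  exact: measurableT_comp measurable_snd m2.
have my : measurable_fun [set: mstate] (fun x => x.2.2.1).
  exact: measurableT_comp measurable_fst m22.
apply: measurable_fun_ifT; [|exact: md|exact: measurable_cst].
apply: (@measurable_fun_nat_param _ _ _ _ (fun x : mstate => x.2.1)
    (fun j x => (j == 0%N) && (x.2.2.1 < 0))) => // j.
apply: measurable_and; first exact: measurable_cst.
by apply: measurable_fun_ltr => //; exact: measurable_cst.
Qed.

Lemma walk_payoff01 (T : Type) h (xi : nat -> T -> R) n y k w : 0 < h ->
  0 <= walk_payoff (walk h xi n y k w) <= 1.
Proof.
move=> h0; have /admissibleP[d01 _] := walk_admissible xi n y k w h0.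
by rewrite /walk_payoff; case: ifP => // _; rewrite lexx ler01.
Qed.

(** The initial correction by the potential, the long-step error of [N] steps, and the discount at
    the horizon, which bounds what unfinished walks contribute. *)
Definition walk_error (h del kap : R) (N : nat) : R :=
  del + N%:R * (expR (- kap * del) * (2 * expR (h * ((p + q + kap) * `|mu| +
    ((p + q + kap) * sigma) ^+ 2 / 2)))) + expR (- lam * h * N%:R).

Lemma walk_payoff_expectation n : exists2 C, 0 <= C &
  forall d (T : measurableType d) (P : probability T R) (xi : nat -> T -> R) h,
  0 < h -> (forall i, measurable_fun [set: T] (xi i)) ->
  (forall m (B : nat -> set R), (forall i, measurable (B i)) ->
    P (\bigcap_(i in `I_m) xi i @^-1` B i) =
    (\prod_(0 <= i < m) normal_prob 0 (Num.sqrt h) (B i))%E) ->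
  forall y del kap N, 0 < del <= 1 -> 0 <= kap ->
  ((payoff_now p q a n y - C * walk_error h del kap N)%:E <=
    \int[P]_w (walk_payoff (walk h xi n y N w))%:E <=
   (payoff_now p q a n y + C * walk_error h del kap N)%:E)%E.
Proof.
have [C1 C10 H1] := lyapunov_drift p0 q0 a0 lam0 pE qE n.
have [C2 C20 H2] := state_value_bound p0 q0 a0 n.
pose C3 : R := C1 * (2 * n%:R + 2).
have C30 : 0 <= C3 by rewrite mulr_ge0// addr_ge0// mulr_ge0.
exists (C1 + C2 + C3); first by rewrite !addr_ge0.
move=> d T P xi h h0 mxi indep y del kap N del01 kap0; rewrite /walk_error.
have /andP[del0 del1] := del01.
set s0 : state := (1, (n, (y, 0))).
set v := payoff_now p q a n y.
set rho := expR (- kap * del) * (2 * _).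
have rho0 : 0 <= rho by rewrite !mulr_ge0 ?expR_ge0.
set disc := expR (- lam * h * N%:R).
set B := (C1 + C2 + C3) * _.
have disc0 : 0 <= disc := expR_ge0 _.
have adm0 : admissible a n s0 := walk_admissible xi n y 0 point h0.
have mwalk : measurable_fun [set: T] (walk h xi n y N : _ -> mstate).
  exact: (measurable_chain mxi s0 (measurable_walk_step a mu sigma lam h)).
have int_pay : P.-integrable setT (fun w => (walk_payoff (walk h xi n y N w))%:E).
  apply: (@bounded_integrable _ _ _ _ (fun w => walk_payoff (walk h xi n y N w)) 1).
    exact: (measurableT_comp measurable_walk_payoff mwalk).
  by move=> w; have /andP[u0 u1] := walk_payoff01 xi n y N w h0; rewrite ger0_norm.
have main eps : `|eps| = 1 ->
  (\int[P]_w (eps * walk_payoff (walk h xi n y N w))%:E <= (eps * v + B)%:E)%E.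
  move=> eps1.
  have [C4 HC4] := lyapunov_bound p0 q0 a0 n eps (C1 * del).
  have := @expectation_chain_le _ _ _ P _ mstate (normal_prob 0 (Num.sqrt h)) xi mxi indep
     (walk_step a mu sigma lam h) s0 (measurable_walk_step a mu sigma lam h)
     (lyapunov p q a n eps (C1 * del)) C4 (C1 * rho) (admissible a n) N
     (measurable_lyapunov p q a n eps (C1 * del)) HC4 adm0
     (fun s z => admissible_step mu sigma a0 lam0 z (ltW h0)).
  have drift s : admissible a n s ->
     (\int[normal_prob 0 (Num.sqrt h)]_z (lyapunov p q a n eps (C1 * del)
        (walk_step a mu sigma lam h (s, z)))%:E <=
       (lyapunov p q a n eps (C1 * del) s + C1 * rho)%:E)%E.
    move=> adm; have := H1 h del kap eps h0 del01 kap0 eps1 s adm.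
    by rewrite -[C1 * expR _ * _]mulrA.
  move=> /(_ drift) Hchain.
  have int_lyap : P.-integrable setT
      (fun w => (lyapunov p q a n eps (C1 * del) (walk h xi n y N w))%:E).
    apply: (@bounded_integrable _ _ _ _ (fun w => lyapunov p q a n eps (C1 * del) (walk h xi n y N w)) C4).
      exact: (measurableT_comp (measurable_lyapunov p q a n eps (C1 * del)) mwalk).
    by move=> w; exact: HC4.
  (* At the horizon the potential is dropped by its sign. An unfinished walk has payoff [0] and
     discount [disc]; a finished one is compared exactly. *)
  apply: (@le_trans _ _ (\int[P]_w (lyapunov p q a n eps (C1 * del) (walk h xi n y N w)
      + C2 * disc)%:E)%E).
    apply: le_integral => //.
    - under eq_fun do rewrite EFinM.
      exact: integrableZl.
    - under eq_fun do rewrite EFinD.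
      by apply: integrableD => //; exact: finite_measure_integrable_cst.
    move=> w _; rewrite lee_fin.
    have adm := walk_admissible xi n y N w h0.
    have dE := @walk_discount T h xi n y N w; rewrite -/disc in dE.
    rewrite /lyapunov adm /walk_payoff.
    have /admissibleP[/andP[d0 d1] vs] := adm.
    have /andP[Q0 _] := potential_bound p0 vs.
    have K0 : 0 <= C1 * del by rewrite mulr_ge0// ltW.
    have Vb := H2 _ vs.
    set s := walk h xi n y N w in d0 d1 vs Q0 Vb dE *.
    have KQ : 0 <= s.1 * (C1 * del * potential p s.2) by rewrite !mulr_ge0// ltW.
    have C2d : 0 <= C2 * disc by rewrite mulr_ge0.
    have [j0|j0] := eqVneq s.2.1 0%N; last first.
      rewrite /= mulr0 mulrDr.
      have : `|s.1 * (eps * state_value p q a s.2)| <= C2 * disc.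
        rewrite normrM (normrM eps) eps1 mul1r (ger0_norm d0) dE// mulrC.
        by rewrite ler_wpM2r.
      by rewrite ler_norml => /andP[]; lra.
    (* The empty Abel sum is [0], so with no drawdown left the value is the indicator of a negative
       distance. *)
    have -> : state_value p q a s.2 = if s.2.2.1 < 0 then 1 else 0.
      case: vs => _ _ _ /(_ j0) D0.
      rewrite /state_value D0 interp0// /payoff_now j0 /total_weight expr0 mul1r.
      by rewrite abel_sum0.
    rewrite /=; case: ifP => _; rewrite ?mulr1 ?mulr0 mulrDr; lra.
  under eq_integral do rewrite EFinD.
  rewrite integralD//; last exact: finite_measure_integrable_cst.
  rewrite integral_cst//= probability_setT mule1.
  apply: (@le_trans _ _ ((lyapunov p q a n eps (C1 * del) s0 + N%:R * (C1 * rho))%:E + (C2 * disc)%:E)%E).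
    exact: leeD2r.
  rewrite -EFinD lee_fin /lyapunov adm0 /= mul1r.
  rewrite /state_value /= interp0// -/v.
  have /andP[_ Q1] : 0 <= potential p (n, (y, 0)) <= 2 * n%:R + 2.
    by have /admissibleP[_ vs] := adm0; have := potential_bound p0 vs.
  have : C1 * del * potential p (n, (y, 0)) <= C3 * del.
    by rewrite /C3 [X in _ <= X]mulrAC ler_wpM2l// mulr_ge0// ltW.
  have t1 : 0 <= C1 * del + C2 * del by rewrite addr_ge0// mulr_ge0// ltW.
  have t2 : 0 <= (C2 + C3) * (N%:R * rho) by rewrite mulr_ge0 ?addr_ge0// mulr_ge0.
  have t3 : 0 <= (C1 + C3) * disc by rewrite mulr_ge0 ?addr_ge0.
  rewrite /B; move: t1 t2 t3; lra.
apply/andP; split.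
  have := main (-1); rewrite normrN1 => /(_ erefl).
  under eq_integral do rewrite EFinM.
  rewrite integralZl// mulN1r EFinN mulN1e leeNl => H; apply: le_trans H.
  by rewrite -EFinN lee_fin; lra.
have := main 1; rewrite normr1 => /(_ erefl).
under eq_integral do rewrite mul1r.
by rewrite mul1r.
Qed.

End walk_payoff.

(** * Vanishing mesh *)

Section mesh.
Context {R : realType}.

(** With [k = i + 1] there are [k ^ 3] steps of length [k ^ -2], and [kap = k] below. The horizon
    [k] tends to infinity, [mesh * kap ^ 2 = 1] keeps the exponential moments bounded, and
    [k ^ 3 exp (- k del)] tends to [0]. *)
Definition mesh (i : nat) : R := (i.+1%:R ^+ 2)^-1.
Definition mesh_steps (i : nat) : nat := (i.+1 ^ 3)%N.

Lemma mesh_gt0 i : 0 < mesh i.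
Proof. by rewrite invr_gt0 exprn_gt0. Qed.

Lemma near_natr_gt (M : R) : \forall i \near \oo, M < i.+1%:R.
Proof.
near=> i; apply: (@lt_le_trans _ _ (Num.truncn M).+1%:R); last first.
  by rewrite ler_nat ltnS; near: i; exact: nbhs_infty_ge.
by have := truncn_le_nat M (Num.truncn M); rewrite leqnn => /esym.
Unshelve. all: by end_near. Qed.

Lemma mesh_to0 eta : 0 < eta -> \forall i \near \oo, mesh i < eta.
Proof.
move=> eta0; apply: filterS (near_natr_gt (eta^-1)) => i Hi.
rewrite /mesh invf_plt ?posrE ?exprn_gt0//.
by apply: lt_le_trans Hi _; rewrite expr2 ler_peMr// ler1n.
Qed.

Lemma mesh_steps_large t :
  \forall i \near \oo, (Num.truncn (t / mesh i) <= mesh_steps i)%N.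
Proof.
apply: filterS (near_natr_gt t) => i Hi.
rewrite truncn_le_nat /mesh invrK -[(mesh_steps i).+1%:R]natr1.
have -> : (mesh_steps i)%:R = i.+1%:R * i.+1%:R ^+ 2 :> R by rewrite -exprS -natrX.
apply: (@le_lt_trans _ _ (i.+1%:R * i.+1%:R ^+ 2)); last by rewrite ltrDl.
by rewrite ler_wpM2r ?exprn_ge0// ltW.
Qed.

Variables (p q mu sigma lam : R).
Hypotheses (p0 : 0 < p) (q0 : 0 < q) (lam0 : 0 < lam).

Lemma walk_error_mesh del : 0 < del -> exists2 C, 0 <= C & forall i,
  walk_error p q mu sigma lam (mesh i) del i.+1%:R (mesh_steps i) <=
  del + C / i.+1%:R.
Proof.
move=> del0.
pose E := expR ((p + q + 1) * `|mu| + ((p + q + 1) * sigma) ^+ 2 / 2).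
(* [24] is [4!], from [u ^ 4 / 4! <= exp u] at [u = k del]; [lam^-1] comes from
   [lam k <= exp (lam k)]. *)
exists (24 / del ^+ 4 * (2 * E) + lam^-1).
  rewrite addr_ge0 ?invr_ge0 ?(ltW lam0)// mulr_ge0 ?mulr_ge0 ?expR_ge0//.
  by rewrite invr_ge0 exprn_ge0// ltW.
move=> i; rewrite /walk_error -addrA lerD2l [X in _ <= X]mulrDl.
set k : R := i.+1%:R.
have k0 : 0 < k by rewrite ltr0n.
have k1 : 1 <= k by rewrite ler1n.
have hE : mesh i = (k ^+ 2)^-1 by [].
have NE : (mesh_steps i)%:R = k ^+ 3 :> R by rewrite natrX.
have pq1 : 0 <= p + q by rewrite addr_ge0// ltW.
apply: lerD.
  have H1 : expR (mesh i * ((p + q + k) * `|mu| + ((p + q + k) * sigma) ^+ 2 / 2)) <= E.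
    rewrite ler_expR hE mulrC ler_pdivrMr ?exprn_gt0//.
    have le1 : p + q + k <= (p + q + 1) * k.
      have : (p + q) * 1 <= (p + q) * k by rewrite ler_wpM2l.
      lra.
    have le2 : (p + q + k) * `|mu| <= (p + q + 1) * `|mu| * k ^+ 2.
      apply: (@le_trans _ _ ((p + q + 1) * k * `|mu|)); first by rewrite ler_wpM2r.
      rewrite [X in X <= _]mulrAC ler_wpM2l//; first by rewrite mulr_ge0//; lra.
      by rewrite expr2 ler_peMr// ltW.
    have le3 : (p + q + k) ^+ 2 <= (p + q + 1) ^+ 2 * k ^+ 2.
      by rewrite -exprMn lerXn2r// nnegrE; [lra|rewrite mulr_ge0//; lra].
    have le4 := ler_wpM2r (sqr_ge0 sigma) le3.
    rewrite [X in _ <= X]mulrDl lerD// !exprMn; lra.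
  have H2 : k ^+ 3 * expR (- k * del) <= 24 / del ^+ 4 / k.
    have := expR_ge1Dxn 3 (ltW (mulr_gt0 k0 del0)).
    rewrite (_ : 4`!%:R = 24 :> R)// => H4.
    have H5 : (k * del) ^+ 4 / 24 <= expR (k * del) by lra.
    rewrite mulNr expRN ler_pdivrMr ?expR_gt0//.
    apply: (@le_trans _ _ (24 / del ^+ 4 / k * ((k * del) ^+ 4 / 24))); last first.
      by rewrite ler_wpM2l// !divr_ge0// ?(ltW k0)// exprn_ge0// ltW.
    rewrite le_eqVlt; apply/orP; left; apply/eqP; field.
    by rewrite !gt_eqF.
  rewrite NE [k ^+ 3 * _]mulrA [X in _ <= X](_ : _ = 24 / del ^+ 4 / k * (2 * E)); last by ring.
  apply: ler_pM; [|by rewrite mulr_ge0 ?expR_ge0|exact: H2|by rewrite ler_wpM2l].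
  by apply: mulr_ge0; [rewrite exprn_ge0// ltW|exact: expR_ge0].
rewrite NE hE (_ : - lam * (k ^+ 2)^-1 * k ^+ 3 = - (lam * k)); last first.
  by field; rewrite gt_eqF.
rewrite expRN -invfM lef_pV2 ?posrE ?expR_gt0 ?mulr_gt0//.
by have := expR_ge1Dx (lam * k); lra.
Qed.

End mesh.

(** * Drawdowns of a path and of its grid samples *)

Section grid_walk.
Context {R : realType}.

(** The walk along a fixed sequence of samples: from here on the comparison with genuine drawdowns
    is deterministic. *)
Fixpoint grid_walk (a lam h : R) (S : nat -> R) (n : nat) (y : R) (k : nat) :
    R * (nat * (R * R)) :=
  if k is k'.+1 then
    let s := grid_walk a lam h S n y k' in
    ((if s.2.1 == 0%N then s.1 else s.1 * expR (- lam * h)),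
     move a s.2 (S k'.+1 - S k'))
  else (1, (n, (y, 0))).

Lemma grid_walkS a lam h S n y k : grid_walk a lam h S n y k.+1 =
  let s := grid_walk a lam h S n y k in
  ((if s.2.1 == 0%N then s.1 else s.1 * expR (- lam * h)),
   move a s.2 (S k.+1 - S k)).
Proof. by []. Qed.

Variables (a lam h : R) (S : nat -> R) (n : nat) (y0 : R).
Hypotheses (a0 : 0 < a) (lam0 : 0 < lam) (h0 : 0 < h).
Local Notation g := (grid_walk a lam h S n y0).

Lemma grid_valid k : valid_state a n (g k).2.
Proof.
elim: k => [|k IH]; first by split.
exact: valid_move.
Qed.

Lemma grid_left_leS k : ((g k.+1).2.1 <= (g k).2.1)%N.
Proof.
rewrite /= /move; case: ifP => // _; case: ifP => // _.
by case: ifP => // _; exact: leq_pred.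
Qed.

Lemma grid_left_le k l : (k <= l)%N -> ((g l).2.1 <= (g k).2.1)%N.
Proof.
move=> /subnKC <-; elim: (l - k)%N => [|i IH]; first by rewrite addn0.
by rewrite addnS (leq_trans (grid_left_leS _)).
Qed.

Lemma grid_done k l : (k <= l)%N -> (g k).2.1 = 0%N -> g l = g k.
Proof.
move=> /subnKC <- gk; elim: (l - k)%N => [|i IH]; first by rewrite addn0.
by rewrite addnS /= IH gk /= /move gk /=; case: (g k).
Qed.

Lemma grid_discount k : (g k).2.1 != 0%N -> (g k).1 = expR (- lam * h * k%:R).
Proof.
elim: k => [|k IH]; first by rewrite mulr0 expR0.
move=> gk; have gk' : (g k).2.1 != 0%N.
  by rewrite -lt0n (leq_trans _ (grid_left_leS k))// lt0n.
by rewrite /= (negbTE gk') IH// -expRD -natr1; congr expR; ring.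
Qed.

Lemma grid_discount_ge k : expR (- lam * h * k%:R) <= (g k).1.
Proof.
elim: k => [|k IH]; first by rewrite mulr0 expR0.
have E : expR (- lam * h * k.+1%:R) = expR (- lam * h * k%:R) * expR (- lam * h).
  by rewrite -expRD -natr1; congr expR; ring.
rewrite /= E; case: ifP => _; last by rewrite ler_wpM2r ?expR_ge0.
apply: le_trans IH; rewrite ler_piMr ?expR_ge0//.
by rewrite -expR0 ler_expR mulNr oppr_le0 mulr_ge0// ltW.
Qed.

Lemma grid_flagged k : y0 < 0 -> (g k).2.2.1 < 0.
Proof.
move=> y00; elim: k => [//|k IH]; rewrite /= /move.
case: ifP => // _; case: ifP => [e0|_] /=; first lra.
by case: ifP => //= _; rewrite IH.
Qed.

(** Within one stage the maximum at [v] is at least every earlier sample of that stage. *)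
Lemma grid_drawdown_ge u v : (u <= v)%N -> (g v).2.1 = (g u).2.1 ->
  (g u).2.1 != 0%N -> S u - S v <= (g v).2.2.2.
Proof.
move=> uv; rewrite -(subnKC uv); elim: (v - u)%N => [|i IH].
  by rewrite addn0 subrr; have [_ + _ _] := grid_valid u.
rewrite addnS => E gu.
have E' : (g (u + i)).2.1 = (g u).2.1.
  apply/eqP; rewrite eqn_leq grid_left_le ?leq_addr//= -[X in (X <= _)%N]E.
  exact: grid_left_leS.
have := IH E' gu; move: E; rewrite /= /move E' (negbTE gu) /=.
set s := g (u + i); case: ifPn => [e0 _ H|e0]; first by rewrite /=; lra.
case: ifPn => [_ /= E|_ _ H /=]; last lra.
by move: gu; rewrite -lt0n -ltn_predL E ltnn.
Qed.

(** Successive falls of size [a], read from the last one backwards. They need not be the falls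
    detected by the walk. *)
Fixpoint drops (a : R) (S : nat -> R) (m k : nat) : Prop :=
  if m is m'.+1 then
    exists u v, [/\ (u <= v)%N, (v <= k)%N, drops a S m' u & a <= S u - S v]
  else True.

(** The walk is greedy: if no drawdown completed between [u] and [v], the drawdown at [v] would be
    at least [a], whereas in a valid state it is below [a]. *)
Lemma grid_complete m k : drops a S m k -> ((g k).2.1 <= n - m)%N.
Proof.
elim: m k => [|m IH] k /=.
  by move=> _; rewrite subn0; have [] := grid_valid k.
move=> [u [v [uv vk /IH gu drop]]].
apply: leq_trans (grid_left_le vk) _.
rewrite leqNgt; apply/negP => gv.
have gvu := grid_left_le uv.
have gv0 : (0 < (g v).2.1)%N by apply: leq_trans gv.
have guv : (g v).2.1 = (g u).2.1.
  apply/eqP; rewrite eqn_leq gvu (leq_trans gu)//.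
  by move: gv; rewrite subnS; case: (n - m)%N.
have gu0 : (g u).2.1 != 0%N by rewrite -guv -lt0n.
have := grid_drawdown_ge uv guv gu0.
by have [_ _ + _] := grid_valid v; lra.
Qed.

End grid_walk.

(** * The walk driven by Brownian samples *)

Section brownian_walk.
Context d (T : measurableType d) (R : realType) (P : probability T R).
Variables (W : R -> {RV P >-> R}) (mu sigma lam p q a : R).
Hypothesis hW : standard_brownian_motion W.
Hypotheses (p0 : 0 < p) (q0 : 0 < q) (a0 : 0 < a) (lam0 : 0 < lam).
Hypothesis pE : p * mu + (p * sigma) ^+ 2 / 2 = lam.
Hypothesis qE : - q * mu + (- q * sigma) ^+ 2 / 2 = lam.

Definition increment (h : R) (k : nat) (w : T) : R :=
  W (k.+1%:R * h) w - W (k%:R * h) w.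

Lemma measurable_increment h k : measurable_fun [set: T] (increment h k).
Proof. exact: measurable_funB. Qed.

Lemma increment_indep h : 0 < h -> forall m (B : nat -> set R),
  (forall i, measurable (B i)) ->
  P (\bigcap_(i in `I_m) increment h i @^-1` B i) =
  (\prod_(0 <= i < m) normal_prob 0 (Num.sqrt h) (B i))%E.
Proof.
move=> h0 m B mB.
have t0 : 0 <= 0%:R * h by rewrite mul0r.
have tS i : (i < m)%N -> i%:R * h < i.+1%:R * h by rewrite ltr_pM2r// ltr_nat.
have := @sbm_independent _ _ _ _ _ hW m (fun i => i%:R * h) t0 tS.
move=> /(_ (fun i => B (val i)) (fun i => mB (val i))).
rewrite big_mkord => E.
have -> : \bigcap_(i in `I_m) increment h i @^-1` B i =
  \bigcap_(i in [set: 'I_m]) (fun w => W ((val i).+1%:R * h) w - W ((val i)%:R * h) w) @^-1` B (val i).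
  apply/seteqP; split => [w Hw i _|w Hw i im].
    exact: (Hw _ (ltn_ord i)).
  exact: (Hw (Ordinal im)).
rewrite E; apply: eq_bigr => i _.
have i0 : 0 <= (val i)%:R * h by rewrite mulr_ge0// ltW.
have iS : (val i)%:R * h < (val i).+1%:R * h by rewrite ltr_pM2r// ltr_nat.
have -> := sbm_gaussian hW i0 iS (mB (val i)).
by rewrite (_ : (val i).+1%:R * h - (val i)%:R * h = h)// -natr1; ring.
Qed.

Lemma walk_grid h n y k w :
  walk a mu sigma lam h (increment h) n y k w =
  grid_walk a lam h (fun k => drifted_path mu sigma (fun t w => W t w) w (k%:R * h)) n y k.
Proof.
elim: k => [//|k IH]; rewrite grid_walkS -IH /walk /= /walk_step /=.
congr (_, move a _ _); rewrite /increment /drifted_path -natr1; ring.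
Qed.

Definition mesh_payoff (n : nat) (y : R) (i : nat) (w : T) : R :=
  walk_payoff (walk a mu sigma lam (mesh i) (increment (mesh i)) n y (mesh_steps i) w).

Lemma mesh_payoff01 n y i w : 0 <= mesh_payoff n y i w <= 1.
Proof. by apply: walk_payoff01 => //; exact: mesh_gt0. Qed.

Lemma measurable_mesh_payoff n y i : measurable_fun [set: T] (mesh_payoff n y i).
Proof.
apply: (measurableT_comp measurable_walk_payoff).
exact: (measurable_chain (measurable_increment (mesh i)) _ (measurable_walk_step a mu sigma lam (mesh i))).
Qed.

Lemma mesh_payoff_expectation n y eta : 0 < eta ->
  \forall i \near \oo,
    ((payoff_now p q a n y - eta)%:E <= \int[P]_w (mesh_payoff n y i w)%:E <=
     (payoff_now p q a n y + eta)%:E)%E.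
Proof.
move=> eta0.
have [C C0 HC] := walk_payoff_expectation p0 q0 a0 lam0 pE qE n.
(* Half of [eta] goes to [C * del]; with [del] fixed, the rest of the error vanishes with the
   mesh. *)
pose del := Num.min 1 (eta / 2 / (C + 1)).
have del0 : 0 < del by rewrite lt_min ltr01/= !divr_gt0// ltr_wpDl.
have del1 : del <= 1 by rewrite ge_min lexx.
have Cdel : C * del <= eta / 2.
  apply: (@le_trans _ _ ((C + 1) * del)); first by rewrite ler_wpM2r ?(ltW del0)//; lra.
  by rewrite mulrC -ler_pdivlMr ?ltr_wpDl// ge_min lexx orbT.
have [C' C'0 HC'] := walk_error_mesh mu sigma p0 q0 lam0 del0.
apply: filterS (near_natr_gt (2 * (C * C') / eta)) => i Hi.
have k0 : 0 < i.+1%:R :> R by [].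
have Cerr : C * walk_error p q mu sigma lam (mesh i) del i.+1%:R (mesh_steps i) <= eta.
  apply: le_trans (ler_wpM2l C0 (HC' i)) _; rewrite mulrDr.
  have : C * (C' / i.+1%:R) <= eta / 2.
    rewrite mulrA ler_pdivrMr//; move: Hi; rewrite ltr_pdivrMr//; lra.
  by move=> Cerr; rewrite [eta]splitr lerD.
have del01 : 0 < del <= 1 by rewrite del0.
have /andP[H1 H2] := HC d T P (increment (mesh i)) (mesh i) (mesh_gt0 i)
  (measurable_increment (mesh i)) (increment_indep (mesh_gt0 i)) y del i.+1%:R
  (mesh_steps i) del01 (ler0n _ _).
apply/andP; split.
  by apply: le_trans H1; rewrite lee_fin; lra.
by apply: le_trans H2 _; rewrite lee_fin; lra.
Qed.

End brownian_walk.

(** * Grid drawdowns are genuine *)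

Section soundness.
Context {R : realType}.
Variables (a lam h : R) (x : R -> R) (n : nat) (y0 : R).
Hypotheses (a0 : 0 < a) (lam0 : 0 < lam) (h0 : 0 < h) (x0 : x 0 = 0).
Local Notation S := (fun k : nat => x (k%:R * h)).
Local Notation g := (grid_walk a lam h S n y0).

(** A sample at [l], not before the stage begins, is a competitor for the stage maximum; [l < k]
    supplies the strict inequality in [drawdown_time]. *)
Lemma drawdown_time_le m (l k : nat) (kappa : nat) :
  (kappa <= l)%N -> (l < k)%N ->
  (drawdown_time a x m <= (kappa%:R * h)%:E)%E -> a <= S l - S k ->
  (drawdown_time a x m.+1 <= (k%:R * h)%:E)%E.
Proof.
move=> kl lk tk drop; rewrite /=; apply: ereal_inf_lbound.
exists (k%:R * h) => //; split.
  apply: le_lt_trans tk _; rewrite lte_fin ltr_pM2r// ltr_nat.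
  exact: leq_ltn_trans lk.
apply: (@le_trans _ _ ((x (l%:R * h))%:E - (x (k%:R * h))%:E)%E).
  by rewrite -EFinB lee_fin.
apply: leeD2r; apply: ereal_sup_ubound; exists (l%:R * h) => //; split.
  by apply: le_trans tk _; rewrite lee_fin ler_pM2r// ler_nat.
by rewrite lee_fin ler_pM2r// ler_nat ltnW.
Qed.

(* Whether a grid maximum up to [k] has exceeded [y0] is what the sign of the
   remaining distance [y] records. *)
Definition grid_max_flag (y : R) (k : nat) : Prop :=
  if y < 0 then exists2 l, (l <= k)%N & y0 < S l
  else forall l, (l <= k)%N -> S l <= y0.

(** [kappa] is a grid index at which the genuine stage has already begun, [l] one where the grid
    maximum [S k + D] of the stage is attained, and [K] the index at which the last drawdown
    completed. The flag is tracked only for [0 <= y0], since a negative start sets it at once. *)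
Definition grid_invariant (k : nat) (s : R * (nat * (R * R))) : Prop :=
  if s.2.1 == 0%N then
    exists K, [/\ (K <= k)%N, s.1 = expR (- lam * h * K%:R),
      (drawdown_time a x n <= (K%:R * h)%:E)%E &
      0 <= y0 -> grid_max_flag s.2.2.1 K]
  else
    (exists kappa l, [/\ (kappa <= l)%N, (l <= k)%N,
       (drawdown_time a x (n - s.2.1) <= (kappa%:R * h)%:E)%E &
       S l = S k + s.2.2.2]) /\
    (0 <= y0 -> grid_max_flag s.2.2.1 k /\
       (0 <= s.2.2.1 -> s.2.2.1 = y0 - (S k + s.2.2.2))).

Lemma grid_sound k : (0 < n)%N -> grid_invariant k (g k).
Proof.
move=> n0; elim: k => [|k IH].
  rewrite /grid_invariant /= eqn0Ngt n0 /=; split.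
    exists 0%N, 0%N; split=> //; first by rewrite subnn mul0r.
    by rewrite addr0.
  move=> y00; split; last by move=> _; rewrite mul0r x0; ring.
  by rewrite /grid_max_flag ltNge y00 /= => l; rewrite leqn0 => /eqP ->; rewrite mul0r x0.
have [gk|gk] := eqVneq (g k).2.1 0%N.
  move: IH; rewrite (grid_done (leqnSn k) gk) /grid_invariant gk /=.
  by move=> [K [Kk ? ? ?]]; exists K; split=> //; exact: ltnW.
have [jn D0 Da _] := @grid_valid R a lam h S n y0 a0 k.
have dk := grid_discount gk.
move: IH; rewrite /grid_invariant (negbTE gk).
rewrite grid_walkS.
case: (g k) gk jn D0 Da dk => d [j [y D]] /= gk jn D0 Da dk.
rewrite (negbTE gk) /move /= (negbTE gk).
move=> [[kappa [l [kl lk tk Sl]]] flag].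
set z := x (k.+1%:R * h) - x (k%:R * h).
case: (ltP (D - z) 0) => e0.
   rewrite /= (negbTE gk); split.
    exists kappa, k.+1; split=> //; first exact: leq_trans (leq_trans kl lk) _.
    by rewrite addr0.
  move=> /flag [fl yE]; rewrite /grid_max_flag in fl *.
  case: (ltP y 0) fl yE => [y00 [l' l'k Sl'] _|y00 fl yE].
    have -> : y + (D - z) < 0 by lra.
    split; last lra.
    by exists l' => //; exact: leqW.
  have E : y + (D - z) = y0 - S k.+1 by rewrite (yE isT) /z; ring.
  split; last by move=> _; rewrite E; ring.
  rewrite E; case: ifP => [lt0|ge0]; first by exists k.+1 => //; lra.
  move=> l'; rewrite leq_eqVlt => /predU1P[->|]; last exact: fl.
  by move: ge0; rewrite ltNge => /negbFE; lra.
case: (leP a (D - z)) => ea.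
  have drop : a <= S l - S k.+1 by rewrite Sl; move: ea; rewrite /z; lra.
  have tk1 := @drawdown_time_le (n - j) l k.+1 kappa kl lk tk drop.
  have jE : (n - j).+1 = (n - j.-1)%N.
    by rewrite -subSn//; case: (j) gk => //.
  rewrite jE in tk1.
  have fl1 : 0 <= y0 -> grid_max_flag (if y < 0 then y else y + (D - z)) k.+1 /\
      (0 <= (if y < 0 then y else y + (D - z)) ->
       (if y < 0 then y else y + (D - z)) = y0 - (S k.+1 + 0)).
    move=> /flag [fl yE]; rewrite /grid_max_flag in fl *.
    case: (ltP y 0) fl yE => [y00 [l' l'k Sl'] _|y00 fl yE].
      rewrite y00; split; last lra.
      by exists l' => //; exact: leqW.
    have E : y + (D - z) = y0 - S k.+1 by rewrite (yE isT) /z; ring.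
    split; last by move=> _; rewrite E; ring.
    have yge : 0 <= y + (D - z) by lra.
    rewrite ltNge yge /= => l'; rewrite leq_eqVlt => /predU1P[->|]; last exact: fl.
    lra.
  rewrite /=; case: ifPn => [j10|j10].
    exists k.+1; split=> //.
    - by rewrite dk -expRD -[k.+1%:R]natr1; congr expR; ring.
    - by move: tk1; rewrite (eqP j10) subn0.
    - by move=> /fl1[].
  split=> //.
  exists k.+1, k.+1; split=> //; last by rewrite addr0.
rewrite /= (negbTE gk); split.
  exists kappa, l; split=> //; first exact: leqW.
  by rewrite Sl /z; ring.
move=> /flag [fl yE]; rewrite /grid_max_flag in fl *.
case: (ltP y 0) fl yE => [y00 [l' l'k Sl'] _|y00 fl yE].
  split; last lra.
  by exists l' => //; exact: leqW.
split; last by move=> _; rewrite (yE isT) /z; ring.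
move=> l'; rewrite leq_eqVlt => /predU1P[->|]; last exact: fl.
have := yE isT; move: e0; rewrite /z; lra.
Qed.

End soundness.

(** * Genuine drawdowns are detected on fine grids *)

Section grid_limits.
Context {R : realType}.
Variables (x : R -> R) (lam : R) (n : nat) (h : nat -> R) (N : nat -> nat).
Hypotheses (lam0 : 0 < lam) (n0 : (0 < n)%N) (x0 : x 0 = 0).
Hypothesis cx : forall u, 0 <= u -> forall e, 0 < e ->
  exists2 eta, 0 < eta & forall v, 0 <= v -> `|v - u| < eta -> `|x v - x u| < e.
Hypothesis h_gt0 : forall i, 0 < h i.
Hypothesis h_to0 : forall eta, 0 < eta -> \forall i \near \oo, h i < eta.
Hypothesis N_large : forall t, \forall i \near \oo, (Num.truncn (t / h i) <= N i)%N.
Local Notation S i := (fun k : nat => x (k%:R * h i)).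
Local Notation tau a := (drawdown_time a x n).

Lemma drawdown_time_ge0 a m : (0 <= drawdown_time a x m)%E.
Proof.
elim: m => [//|m IH] /=; apply: le_ereal_inf_tmp => _ [t [mt _] <-].
by apply: ltW; apply: le_lt_trans mt.
Qed.

(** The counterpart of [drops] in continuous time: finitely many inequalities between path values,
    which survive small perturbations and so transfer to a fine grid. *)
Fixpoint real_drops (a : R) (m : nat) (t : R) : Prop :=
  if m is m'.+1 then
    exists u v, [/\ u <= v, v <= t, real_drops a m' u & a <= x u - x v]
  else 0 <= t.

Lemma real_drops_ge0 a m t : real_drops a m t -> 0 <= t.
Proof.
elim: m t => [//|m IH] t /= [u [v [uv vt /IH u0 _]]].
exact: le_trans u0 (le_trans uv vt).
Qed.

(** Level is lost twice per stage: once because the supremum is only approached, once because the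
    approaching time is moved; [a''] separates the two losses. *)
Lemma real_drops_lt a a' m t : 0 < a' -> a' < a ->
  (drawdown_time a x m < t%:E)%E -> real_drops a' m t.
Proof.
move=> a'0 a'a; elim: m t => [|m IH] t /=; first by rewrite lte_fin => /ltW.
move=> /ereal_inf_lt[_ [t' [mt' drop] <-]]; rewrite lte_fin => t't.
pose a'' := (a + a') / 2.
have : ((a'' + x t')%:E < running_max x (drawdown_time a x m) t'%:E)%E.
  apply: (@lt_le_trans _ _ (a%:E + (x t')%:E)%E).
    by rewrite -EFinD lte_fin ltrD2r /a''; lra.
  by rewrite -leeBrDr.
move=> /ereal_sup_gt[_ [u [mu ut'] <-]]; rewrite lte_fin => xu.
have u0 : 0 <= u by rewrite -lee_fin; exact: le_trans (drawdown_time_ge0 a m) mu.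
have gap : 0 < a'' - a' by rewrite /a''; lra.
have a''0 : 0 < a'' by rewrite /a''; lra.
have [eta eta0 Heta] := cx u0 gap.
rewrite lee_fin in ut'.
have ut : u < t'.
  by rewrite lt_neqAle ut' andbT; apply/eqP => E; move: xu; rewrite E; lra.
(* [u] may coincide with the previous drawdown time, while the induction needs a strictly later
   time; continuity allows a small shift to the right that stays before [t']. *)
pose u' := u + Num.min (t' - u) eta / 2.
have m0 : 0 < Num.min (t' - u) eta by rewrite lt_min eta0 andbT; lra.
have m1 : Num.min (t' - u) eta <= t' - u by rewrite ge_min lexx.
have m2 : Num.min (t' - u) eta <= eta by rewrite ge_min lexx orbT.
exists u', t'; split.
- by rewrite /u'; lra.
- exact: ltW.
- by apply: IH; apply: le_lt_trans mu _; rewrite lte_fin /u'; lra.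
- have u'0 : 0 <= u' by rewrite /u'; lra.
  have : `|u' - u| < eta by rewrite /u' ger0_norm; lra.
  by move=> /(Heta _ u'0); rewrite ltr_norml => /andP[]; lra.
Qed.

Let index i u := Num.truncn (u / h i).

Let index_itv i u : 0 <= u ->
  (index i u)%:R * h i <= u /\ u < (index i u)%:R * h i + h i.
Proof.
move=> u0; have := truncn_itv (divr_ge0 u0 (ltW (h_gt0 i))).
rewrite -/(index i u) ler_pdivlMr ?h_gt0// ltr_pdivrMr ?h_gt0// => /andP[H1 H2].
by split=> //; rewrite -natr1 mulrDl mul1r in H2.
Qed.

Let index_le i u v : u <= v -> (index i u <= index i v)%N.
Proof. by move=> uv; apply: le_truncn; rewrite ler_pM2r ?invr_gt0. Qed.

Lemma near_index u e : 0 <= u -> 0 < e ->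
  \forall i \near \oo, `|S i (index i u) - x u| < e.
Proof.
move=> u0 e0; have [eta eta0 Heta] := cx u0 e0.
apply: filterS (h_to0 eta0) => i hi; apply: Heta.
  by rewrite mulr_ge0// ltW.
have [H1 H2] := index_itv i u0.
by rewrite distrC ger0_norm; lra.
Qed.

Lemma near_drops a a' m t : a' < a -> real_drops a m t ->
  \forall i \near \oo, drops a' (S i) m (index i t).
Proof.
move=> a'a; elim: m t => [|m IH] t /=; first by move=> _; exact: nearW.
move=> [u [v [uv vt dm drop]]].
have u0 := real_drops_ge0 dm.
have v0 : 0 <= v := le_trans u0 uv.
have e0 : 0 < (a - a') / 2 by lra.
near=> i.
exists (index i u), (index i v); split; [exact: index_le|exact: index_le| |].
- by near: i; exact: IH.
- have : `|S i (index i u) - x u| < (a - a') / 2 by near: i; exact: near_index.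
  have : `|S i (index i v) - x v| < (a - a') / 2 by near: i; exact: near_index.
  by rewrite !ltr_norml => /andP[? ?] /andP[? ?]; lra.
Unshelve. all: by end_near. Qed.

Local Notation walk_of a y i k := (grid_walk a lam (h i) (S i) n y k).
Definition grid_payoff a y i : R := walk_payoff (walk_of a y i (N i)).

Lemma grid_payoff_ge0 a y i : 0 <= grid_payoff a y i.
Proof.
rewrite /grid_payoff /walk_payoff; case: ifP => // _.
exact: le_trans (expR_ge0 _) (grid_discount_ge _ _ _ _ lam0 (h_gt0 i) _).
Qed.

Lemma grid_payoff_le a y i t : 0 < a -> (t%:E < tau a)%E ->
  grid_payoff a y i <= expR (- lam * t).
Proof.
move=> a0 tt; rewrite /grid_payoff /walk_payoff.
case: ifP => [/andP[j0 _]|_]; last exact: expR_ge0.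
have := grid_sound lam y a0 (h_gt0 i) x0 (N i) n0.
rewrite /grid_invariant j0 => -[K [_ -> tK _]].
have tKh : t < K%:R * h i by rewrite -lte_fin (lt_le_trans tt).
rewrite ler_expR -mulrA !mulNr lerN2 ler_wpM2l ?(ltW lam0)// mulrC.
exact: ltW.
Qed.

Lemma near_done a a' y t : 0 < a' -> a' < a -> (tau a < t%:E)%E ->
  \forall i \near \oo, (walk_of a' y i (index i t)).2.1 = 0%N /\ (index i t <= N i)%N.
Proof.
move=> a'0 a'a taut; pose a1 := (a + a') / 2.
have a10 : 0 < a1 by rewrite /a1; lra.
have a1a : a1 < a by rewrite /a1; lra.
have a'a1 : a' < a1 by rewrite /a1; lra.
have dr := real_drops_lt a10 a1a taut.
near=> i; split; last by near: i; exact: N_large.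
have /(grid_complete lam (h i) n y a'0) : drops a' (S i) n (index i t).
  by near: i; exact: near_drops dr.
by rewrite subnn leqn0 => /eqP.
Unshelve. all: by end_near. Qed.

Let walk_done a y i t : 0 < a -> 0 <= t ->
  (walk_of a y i (index i t)).2.1 = 0%N /\ (index i t <= N i)%N ->
  exists K, [/\ (K <= index i t)%N, (walk_of a y i (N i)).2.1 = 0%N,
    (walk_of a y i (N i)).1 = expR (- lam * h i * K%:R),
    (tau a <= (K%:R * h i)%:E)%E &
    0 <= y -> grid_max_flag (h i) x y (walk_of a y i (N i)).2.2.1 K].
Proof.
move=> a0 t0 [done le_N]; have gN := grid_done le_N done.
have := grid_sound lam y a0 (h_gt0 i) x0 (index i t) n0.
rewrite /grid_invariant done eqxx -gN => -[K [? ? ? ?]].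
by exists K; split=> //; rewrite gN.
Qed.

Let discount_ge i K t : 0 <= t -> (K <= index i t)%N ->
  expR (- lam * t) <= expR (- lam * h i * K%:R).
Proof.
move=> t0 Kt; rewrite ler_expR -mulrA !mulNr lerN2 ler_wpM2l ?(ltW lam0)// mulrC.
have [H1 _] := index_itv i t0; apply: le_trans H1.
by rewrite ler_wpM2r ?ler_nat// ltW.
Qed.

Let tau_lt_ge0 a t : (tau a < t%:E)%E -> 0 <= t.
Proof.
by move=> taut; rewrite -lee_fin; apply: le_trans (ltW taut); exact: drawdown_time_ge0.
Qed.

Lemma near_payoff_ge a a' y t : y < 0 -> 0 < a' -> a' < a -> (tau a < t%:E)%E ->
  \forall i \near \oo, expR (- lam * t) <= grid_payoff a' y i.
Proof.
move=> y0 a'0 a'a taut; have t0 := tau_lt_ge0 taut.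
apply: filterS (near_done y a'0 a'a taut) => i /(walk_done a'0 t0)[K [Kt j0 dE _ _]].
by rewrite /grid_payoff /walk_payoff j0 eqxx grid_flagged//= dE; exact: discount_ge.
Qed.

(** The walk at level [a] itself ends no earlier than [tau a], hence after a sample close to a time
    [u] where the path exceeds [y]; the level [a''] only ensures that it ends by [t]. *)
Lemma near_payoff_exceeded_ge a a'' y t : 0 <= y -> 0 < a -> a < a'' ->
  (y%:E < running_max x 0 (tau a))%E -> (tau a'' < t%:E)%E ->
  \forall i \near \oo, expR (- lam * t) <= grid_payoff a y i.
Proof.
move=> y0 a0 aa'' /ereal_sup_gt[_ [u [u0 utau] <-]]; rewrite lte_fin => yu taut.
have t0 := tau_lt_ge0 taut; rewrite lee_fin in u0.
have gap : 0 < x u - y by lra.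
near=> i.
have [K [Kt j0 dE tK flag]] : exists K, [/\ (K <= index i t)%N, (walk_of a y i (N i)).2.1 = 0%N,
    (walk_of a y i (N i)).1 = expR (- lam * h i * K%:R),
    (tau a <= (K%:R * h i)%:E)%E &
    0 <= y -> grid_max_flag (h i) x y (walk_of a y i (N i)).2.2.1 K].
  by apply: walk_done => //; near: i; exact: near_done taut.
have uK : (index i u <= K)%N.
  have : u <= K%:R * h i by rewrite -lee_fin; exact: le_trans utau tK.
  move=> /(index_le i); rewrite /index mulfK ?gt_eqF//.
  by rewrite natrK.
have xiu : `|S i (index i u) - x u| < x u - y by near: i; exact: near_index.
rewrite /grid_payoff /walk_payoff j0 eqxx /=.
have := flag y0; rewrite /grid_max_flag; case: ifP => [_ _|_ /(_ _ uK)].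
  by rewrite dE; exact: discount_ge.
by move: xiu; rewrite ltr_norml => /andP[]; lra.
Unshelve. all: by end_near. Qed.

(** At the smaller level the walk ends at most slightly after [tau a], and by continuity the path
    cannot climb from [y] to [y'] in the time left. If [tau a] is infinite, the path never exceeds
    [y]. *)
Lemma near_payoff_not_exceeded a a' y y' : y < y' -> 0 <= y' -> 0 < a' -> a' < a ->
  ~ (y%:E < running_max x 0 (tau a))%E ->
  \forall i \near \oo, grid_payoff a' y' i = 0.
Proof.
move=> yy' y'0 a'0 a'a /negP; rewrite -leNgt => Mle.
have xle u : 0 <= u -> (u%:E <= tau a)%E -> x u <= y.
  move=> u0 ut; rewrite -lee_fin; apply: le_trans Mle.
  by apply: ereal_sup_ubound; exists u.
case tauE : (tau a) => [T| |]; last first.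
- by have := drawdown_time_ge0 a n; rewrite tauE.
- apply: nearW => i; rewrite /grid_payoff /walk_payoff; case: ifP => // /andP[j0 fl].
  have := grid_sound lam y' a'0 (h_gt0 i) x0 (N i) n0.
  rewrite /grid_invariant j0 => -[K [_ _ _ /(_ y'0)]].
  rewrite /grid_max_flag fl => -[l _ lt].
  have : S i l <= y by apply: xle; rewrite ?tauE ?leey// mulr_ge0// ltW.
  by move: lt => /=; lra.
have T0 : 0 <= T by rewrite -lee_fin -tauE; exact: drawdown_time_ge0.
have gap : 0 < y' - y by lra.
have [eta eta0 Heta] := cx T0 gap.
have taut : (tau a < (T + eta / 2)%:E)%E by rewrite tauE lte_fin; lra.
have t0 := tau_lt_ge0 taut.
apply: filterS (near_done y' a'0 a'a taut) => i /(walk_done a'0 t0)[K [Kt j0 dE _ /(_ y'0)]].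
rewrite /grid_payoff /walk_payoff j0 eqxx /grid_max_flag /=; case: ifP => // _ [l lK lt].
have l0 : 0 <= l%:R * h i by rewrite mulr_ge0// ltW.
have lt' : l%:R * h i <= T + eta / 2.
  have [H1 _] := index_itv i t0; apply: le_trans H1.
  by rewrite ler_wpM2r ?(ltW (h_gt0 i))// ler_nat (leq_trans lK).
have [lT|Tl] := leP (l%:R * h i) T.
  have : x (l%:R * h i) <= y by apply: xle => //; rewrite tauE lee_fin.
  lra.
have : `|l%:R * h i - T| < eta by rewrite ger0_norm; lra.
have xT : x T <= y by apply: xle => //; rewrite tauE.
by move=> /(Heta _ l0); rewrite ltr_norml => /andP[]; lra.
Qed.

Local Notation D a := (discount lam (tau a)).

Lemma discount_fin t : discount lam t%:E = expR (- lam * t).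
Proof. by rewrite /discount -EFinM -EFinN /= mulNr. Qed.

Lemma discount_pinfty : discount lam +oo%E = 0.
Proof. by rewrite /discount mulry gtr0_sg// mul1e. Qed.

Lemma discount01 a : 0 <= D a <= 1.
Proof.
have := drawdown_time_ge0 a n; case: (tau a) => [t| |]//.
  rewrite lee_fin => t0; rewrite discount_fin expR_ge0 /=.
  by rewrite -expR0 ler_expR mulNr oppr_le0 mulr_ge0// ltW.
by rewrite discount_pinfty lexx ler01.
Qed.

(** The delay that divides the discount by exactly [1 + eta], so that it costs at most [eta]. *)
Let shift (eta : R) := ln (1 + eta) / lam.
Let shift_gt0 eta : 0 < eta -> 0 < shift eta.
Proof. by move=> eta0; rewrite divr_gt0// ln_gt0//; lra. Qed.
Let expR_shift eta : 0 < eta -> expR (lam * shift eta) = 1 + eta.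
Proof.
move=> eta0; rewrite /shift mulrC divfK ?gt_eqF// lnK// posrE; lra.
Qed.

Let discount_shift T eta u : 0 <= T -> 0 < eta ->
  expR (- lam * (T + shift eta)) <= u -> expR (- lam * T) <= u + eta.
Proof.
move=> T0 eta0 Hu.
have E : expR (- lam * T) = expR (- lam * (T + shift eta)) * (1 + eta).
  by rewrite -expR_shift// -expRD; congr expR; ring.
rewrite E mulrDr mulr1 lerD// ler_piMl ?(ltW eta0)//.
rewrite -expR0 ler_expR mulNr oppr_le0 mulr_ge0 ?(ltW lam0)// addr_ge0// ltW//.
exact: shift_gt0.
Qed.

Lemma near_payoff_le_discount a y eta : 0 < a -> 0 < eta ->
  \forall i \near \oo, grid_payoff a y i <= D a + eta.
Proof.
move=> a0 eta0; apply: nearW => i.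
have := drawdown_time_ge0 a n; case tauE : (tau a) => [T| |]//.
  rewrite lee_fin => T0; rewrite discount_fin.
  apply: le_trans (@grid_payoff_le a y i (T - shift eta) a0 _) _.
    by rewrite tauE lte_fin; have := shift_gt0 eta0; lra.
  have -> : - lam * (T - shift eta) = - lam * T + lam * shift eta by ring.
  rewrite expRD expR_shift// mulrDr mulr1 lerD2l ler_piMl ?(ltW eta0)//.
  by rewrite -expR0 ler_expR mulNr oppr_le0 mulr_ge0// ltW.
move=> _; rewrite discount_pinfty add0r.
(* With an infinite drawdown time every [t] is allowed; this one makes [exp (- lam t)] equal to
   [eta]. *)
apply: le_trans (@grid_payoff_le a y i (- ln eta / lam) a0 _) _.
  by rewrite tauE ltry.
rewrite (_ : - lam * (- ln eta / lam) = ln eta) ?lnK//.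
by field; rewrite gt_eqF.
Qed.

Lemma near_discount_le_payoff a a' y eta : y < 0 -> 0 < a' -> a' < a -> 0 < eta ->
  \forall i \near \oo, D a <= grid_payoff a' y i + eta.
Proof.
move=> y0 a'0 a'a eta0.
have := drawdown_time_ge0 a n; case tauE : (tau a) => [T| |]//; last first.
  move=> _; rewrite discount_pinfty; apply: nearW => i.
  by rewrite addr_ge0 ?grid_payoff_ge0// ltW.
rewrite lee_fin discount_fin => T0.
have taut : (tau a < (T + shift eta)%:E)%E.
  by rewrite tauE lte_fin; have := shift_gt0 eta0; lra.
apply: filterS (near_payoff_ge y0 a'0 a'a taut) => i; exact: discount_shift.
Qed.

Lemma near_discount_le_payoff_exceeded a a'' y eta : 0 <= y -> 0 < a -> a < a'' ->
  0 < eta -> (y%:E < running_max x 0 (tau a))%E ->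
  \forall i \near \oo, D a'' <= grid_payoff a y i + eta.
Proof.
move=> y0 a0 aa'' eta0 Mx.
have := drawdown_time_ge0 a'' n; case tauE : (tau a'') => [T| |]//; last first.
  move=> _; rewrite discount_pinfty; apply: nearW => i.
  by rewrite addr_ge0 ?grid_payoff_ge0// ltW.
rewrite lee_fin discount_fin => T0.
have taut : (tau a'' < (T + shift eta)%:E)%E.
  by rewrite tauE lte_fin; have := shift_gt0 eta0; lra.
apply: filterS (near_payoff_exceeded_ge y0 a0 aa'' Mx taut) => i; exact: discount_shift.
Qed.

End grid_limits.

(** * Fatou's lemma without measurability of the limit *)

Section limn_einf_bounds.
Context {R : realType}.
Local Open Scope ereal_scope.
Implicit Types (u : (\bar R)^nat) (l : \bar R).

Let limn_einf_sup_range u : limn_einf u = ereal_sup (range (einfs u)).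
Proof.
rewrite limn_einf_lim; apply/cvg_lim => //.
exact/ereal_nondecreasing_cvgn/nondecreasing_einfs.
Qed.

Lemma near_le_limn_einf u l : (\forall i \near \oo, l <= u i) -> l <= limn_einf u.
Proof.
move=> [n _ Hn]; rewrite limn_einf_sup_range.
apply: (@le_trans _ _ (einfs u n)); last by apply: ereal_sup_ubound; exists n.
by apply: le_ereal_inf_tmp => _ [m nm <-]; exact: Hn.
Qed.

Lemma limn_einf_le_near u l : (\forall i \near \oo, u i <= l) -> limn_einf u <= l.
Proof.
move=> [n _ Hn]; rewrite limn_einf_sup_range; apply: ge_ereal_sup => _ [m _ <-].
apply: (@le_trans _ _ (u (maxn n m))); last by apply: Hn => /=; exact: leq_maxl.
by apply: ereal_inf_lbound; exists (maxn n m) => //=; exact: leq_maxr.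
Qed.

End limn_einf_bounds.

Section fatou_sandwich.
Context d (T : measurableType d) (R : realType) (P : probability T R).
Local Open Scope ereal_scope.

(* The integral of a nonnegative function is a supremum over the simple functions
   below it, hence monotone even without measurability. *)
Lemma ge0_le_integral_nonmeasurable (f g : T -> \bar R) :
  (forall w, 0 <= f w) -> (forall w, f w <= g w) ->
  \int[P]_w f w <= \int[P]_w g w.
Proof.
move=> f0 fg; have g0 w : 0 <= g w := le_trans (f0 w) (fg w).
rewrite !ge0_integralTE//; apply: le_ereal_sup => _ [h hf <-].
by exists h => // w; exact: le_trans (hf w) (fg w).
Qed.

Variables (Z : nat -> T -> R) (z : R).
Hypotheses (mZ : forall i, measurable_fun setT (Z i)) (Z0 : forall i w, (0 <= Z i w)%R).
Hypothesis Zz : forall eta : R, (0 < eta)%R ->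
  \forall i \near \oo, \int[P]_w (Z i w)%:E <= (z + eta)%:E.

Let g w := limn_einf (fun i => (Z i w)%:E).

Let mg : measurable_fun setT g.
Proof.
rewrite /g /limn_einf; apply: measurableT_comp => //.
apply: measurable_fun_limn_esup => i.
by apply: measurableT_comp => //; exact/measurable_EFinP.
Qed.

Let g0 w : 0 <= g w.
Proof. by apply: near_le_limn_einf; apply: nearW => i; rewrite lee_fin. Qed.

Let int_g : \int[P]_w g w <= z%:E.
Proof.
have mEZ i : measurable_fun setT (fun w => (Z i w)%:E) by apply/measurable_EFinP.
have := @fatou _ _ _ P setT measurableT (fun i w => (Z i w)%:E) mEZ (fun i w _ => Z0 i w).
move=> /le_trans; apply; apply/lee_addgt0Pr => eta eta0.
by rewrite -EFinD; apply: limn_einf_le_near; exact: Zz.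
Qed.

Let le_g (v : T -> R) :
  {ae P, forall w, forall eta : R, (0 < eta)%R -> \forall i \near \oo, (v w <= Z i w + eta)%R} ->
  exists2 A : set T, measurable A /\ P A = 0 & forall w, ~ A w -> (v w)%:E <= g w.
Proof.
move=> [A [mA A0 HA]]; exists A => // w nAw.
apply/lee_addgt0Pr => eta eta0; rewrite -leeBlDr//; apply: near_le_limn_einf.
have [H|H] := pselect (forall eta : R, (0 < eta)%R -> \forall i \near \oo, (v w <= Z i w + eta)%R).
  apply: filterS (H _ eta0) => i; rewrite -EFinB lee_fin; lra.
by exfalso; apply: nAw; apply: HA => /=.
Qed.

(** Off a null set [f + c] is below the lower limit [g] of the [Z i], so [g - c], set to infinity on
    the null set, is a measurable majorant of [f]. The constant [c] leaves room to make the [Z i]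
    nonnegative. *)
Lemma integral_le_fatou (f : T -> R) (c : R) : (forall w, (0 <= f w)%R) -> (0 <= c)%R ->
  {ae P, forall w, forall eta : R, (0 < eta)%R ->
     \forall i \near \oo, (f w + c <= Z i w + eta)%R} ->
  \int[P]_w (f w)%:E <= (z - c)%:E.
Proof.
move=> f0 c0 /le_g[A [mA PA0] HA].
pose G w : \bar R := if w \in A then +oo else g w - c%:E.
have G0 w : 0 <= G w.
  rewrite /G; case: ifPn => // /negP; rewrite inE => nAw.
  rewrite leeBrDr// add0e; apply: le_trans (HA w nAw).
  by rewrite lee_fin lerDr.
have mA' : measurable_fun setT (fun w => w \in A).
  apply: (@measurable_fun_bool _ _ _ _ true).
  by rewrite setTI (_ : _ @^-1` _ = A)//; apply/seteqP; split => w /=; [exact: set_mem|exact: mem_set].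
have mG : measurable_fun setT G.
  apply: measurable_fun_ifT => //; last by apply: emeasurable_funB => //; exact: measurable_cst.
have fG w : (f w)%:E <= G w.
  rewrite /G; case: ifPn => [_|/negP]; first by rewrite leey.
  by rewrite inE => /HA; rewrite leeBrDr.
apply: le_trans (ge0_le_integral_nonmeasurable _ fG) _; first by move=> w; rewrite lee_fin.
rewrite EFinB leeBrDr//.
apply: le_trans int_g.
have -> : \int[P]_w G w + c%:E = \int[P]_w (G w + c%:E).
  by rewrite ge0_integralD// integral_cst//= probability_setT mule1.
rewrite le_eqVlt; apply/orP; left; apply/eqP.
apply: ge0_ae_eq_integral => //.
- by apply: emeasurable_funD => //; exact: measurable_cst.
- by move=> w _; rewrite adde_ge0.
exists A; split => // w /= /not_implyP[_].
apply: contra_notP => nAw; rewrite /G; case: ifPn => [|_]; first by rewrite inE.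
by rewrite subeK.
Qed.

(** Here the positive part of [c - g], set to [0] on the null set, is a measurable minorant of [f],
    and its sum with [g] is at least [c] almost everywhere. *)
Lemma integral_ge_fatou (f : T -> R) (c : R) : (forall w, (0 <= f w)%R) -> (0 <= c)%R ->
  {ae P, forall w, forall eta : R, (0 < eta)%R ->
     \forall i \near \oo, (c - f w <= Z i w + eta)%R} ->
  (c - z)%:E <= \int[P]_w (f w)%:E.
Proof.
move=> f0 c0 /le_g[A [mA PA0] HA].
pose G w : \bar R := if w \in A then 0 else maxe 0 (c%:E - g w).
have G0 w : 0 <= G w by rewrite /G; case: ifP => // _; rewrite le_max lexx.
have mA' : measurable_fun setT (fun w => w \in A).
  apply: (@measurable_fun_bool _ _ _ _ true).
  by rewrite setTI (_ : _ @^-1` _ = A)//; apply/seteqP; split => w /=; [exact: set_mem|exact: mem_set].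
have mG : measurable_fun setT G.
  apply: measurable_fun_ifT => //; apply: measurable_maxe => //.
  by apply: emeasurable_funB => //; exact: measurable_cst.
have Gf w : G w <= (f w)%:E.
  rewrite /G; case: ifPn => [_|/negP]; first by rewrite lee_fin.
  rewrite inE => /HA H; rewrite ge_max lee_fin f0 /=.
  move: H; case: (g w) (g0 w) => [r| |]//; last by rewrite leNye.
  by move=> _; rewrite !lee_fin; lra.
apply: le_trans (ge0_le_integral_nonmeasurable G0 Gf).
rewrite EFinB leeBlDr//.
apply: (@le_trans _ _ (\int[P]_w G w + \int[P]_w g w)); last exact: leeD2l.
rewrite -ge0_integralD//.
apply: (@le_trans _ _ (\int[P]_w (cst c%:E w))).
  by rewrite integral_cst//= probability_setT mule1.
apply: ae_ge0_le_integral => //.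
- by move=> w _; rewrite adde_ge0.
- exact: emeasurable_funD.
exists A; split => // w /= /not_implyP[_].
apply: contra_notP => nAw; rewrite /G; case: ifPn => [|_]; first by rewrite inE.
case: (g w) (g0 w) => [r r0| |]//; last first.
  by rewrite addey ?leey// gt_eqF// (lt_le_trans (ltNyr 0%R))// le_max lexx.
by rewrite -EFinB -EFin_max -EFinD lee_fin -lerBlDr le_max lexx orbT.
Qed.

End fatou_sandwich.

(** * Continuity of the formula *)

Section continuity.
Context {R : realType}.
Variables (p q a y : R).
Hypotheses (p0 : 0 < p) (q0 : 0 < q) (a0 : 0 < a).
Variables (U : Type) (F : set_system U) (FF : Filter F) (al ys : U -> R).
Hypotheses (cal : al t @[t --> F] --> a) (cys : ys t @[t --> F] --> y).

Let cvg_expRM (k : R) (f : U -> R) (l : R) : f t @[t --> F] --> l ->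
  expR (k * f t) @[t --> F] --> expR (k * l).
Proof.
move=> cf; apply: (@continuous_cvg _ _ _ _ _ _ expR); first exact: continuous_expR.
by apply: cvgM => //; exact: cvg_cst.
Qed.

Let cvg_den : (exit_den p q (al t))^-1 @[t --> F] --> (exit_den p q a)^-1.
Proof.
apply: cvgV; first by rewrite gt_eqF// exit_den_gt0.
by apply: cvgB; exact: cvg_expRM.
Qed.

Lemma cvg_exit_b : exit_b p q (al t) @[t --> F] --> exit_b p q a.
Proof.
apply: cvgM cvg_den; apply: cvgD; apply: cvgM; (try exact: cvg_cst); exact: cvg_expRM.
Qed.

Lemma cvg_exit_c : exit_c p q (al t) @[t --> F] --> exit_c p q a.
Proof. by apply: cvgM cvg_den; exact: cvg_cst. Qed.

Let cvg_exp (f : U -> R) (l : R) k : f t @[t --> F] --> l ->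
  (f t) ^+ k @[t --> F] --> l ^+ k.
Proof.
move=> cf; elim: k => [|k IH]; first exact: cvg_cst.
by under eq_fun do rewrite exprS; rewrite exprS; exact: cvgM.
Qed.

Lemma cvg_total_weight n :
  total_weight p q (al t) n @[t --> F] --> total_weight p q a n.
Proof.
apply: cvg_exp; apply: cvgM cvg_exit_c _; apply: cvgV cvg_exit_b.
by rewrite gt_eqF// exit_b_gt0.
Qed.

Lemma cvg_abel m : abel (al t) m (ys t) @[t --> F] --> abel a m y.
Proof.
case: m => [|m] /=; first exact: cvg_cst.
apply: cvgM; last exact: cvg_cst.
apply: cvgM => //; apply: cvg_exp; apply: cvgD => //.
by apply: cvgM => //; exact: cvg_cst.
Qed.

Lemma cvg_abel_sum n :
  abel_sum (al t) (exit_b p q (al t)) n (ys t) @[t --> F] -->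
  abel_sum a (exit_b p q a) n y.
Proof.
have cb := cvg_exit_b.
have cexp (f g : U -> R) (l k : R) : f t @[t --> F] --> l -> g t @[t --> F] --> k ->
    expR (- f t * g t) @[t --> F] --> expR (- l * k).
  move=> cf cg; apply: (@continuous_cvg _ _ _ _ _ _ expR); first exact: continuous_expR.
  by apply: cvgM => //; exact: cvgN.
rewrite /abel_sum; elim: n => [|n IH].
  by under eq_fun do rewrite big_geq//; rewrite big_geq//; exact: cvg_cst.
under eq_fun do rewrite big_nat_recr//=; rewrite big_nat_recr//=.
apply: cvgD => //; apply: cvgM; last exact: cexp.
apply: cvgM; last exact: cvg_abel.
by apply: cvg_exp; apply: cvgM => //; exact: cexp.
Qed.

End continuity.

(** * The squeeze *)

Section exponents.
Context {R : realType}.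
Variables (mu sigma lam : R).
Hypotheses (sigma0 : 0 < sigma) (lam0 : 0 < lam).
Local Notation p := (beta_plus mu sigma lam).
Local Notation q := (- beta_minus mu sigma lam).
Let root : R := Num.sqrt (mu ^+ 2 + 2 * lam * sigma ^+ 2).

Let disc_gt : mu ^+ 2 < mu ^+ 2 + 2 * lam * sigma ^+ 2.
Proof. by rewrite ltrDl !mulr_gt0// exprn_gt0. Qed.

Let root_gt : `|mu| < root.
Proof.
by rewrite -sqrtr_sqr ltr_sqrt// (le_lt_trans _ disc_gt)// sqr_ge0.
Qed.

Let rootE : root ^+ 2 = mu ^+ 2 + 2 * lam * sigma ^+ 2.
Proof. by rewrite sqr_sqrtr// ltW// (le_lt_trans _ disc_gt)// sqr_ge0. Qed.

Lemma beta_plus_gt0 : 0 < p.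
Proof.
rewrite /beta_plus -/root divr_gt0 ?exprn_gt0//.
by have := ler_norm mu; have := root_gt; lra.
Qed.

Lemma beta_minus_lt0 : 0 < q.
Proof.
rewrite /beta_minus -/root -mulNr divr_gt0 ?exprn_gt0//.
by have := ler_norm (- mu); rewrite normrN; have := root_gt; lra.
Qed.

Lemma beta_plusE : p * mu + (p * sigma) ^+ 2 / 2 = lam.
Proof.
rewrite /beta_plus -/root.
have -> : ((- mu + root) / sigma ^+ 2) * mu + ((- mu + root) / sigma ^+ 2 * sigma) ^+ 2 / 2
   = (root ^+ 2 - mu ^+ 2) / (2 * sigma ^+ 2) by field; rewrite gt_eqF.
by rewrite rootE; field; rewrite gt_eqF.
Qed.

Lemma beta_minusE : - q * mu + (- q * sigma) ^+ 2 / 2 = lam.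
Proof.
rewrite opprK /beta_minus -/root.
have -> : ((- mu - root) / sigma ^+ 2) * mu + ((- mu - root) / sigma ^+ 2 * sigma) ^+ 2 / 2
   = (root ^+ 2 - mu ^+ 2) / (2 * sigma ^+ 2) by field; rewrite gt_eqF.
by rewrite rootE; field; rewrite gt_eqF.
Qed.

Lemma b_coefE a : b_coef mu sigma a lam = exit_b p q a.
Proof. by congr (_ / _); rewrite [X in _ = _ + X]mulNr. Qed.

Lemma c_coefE a : c_coef mu sigma a lam = exit_c p q a.
Proof. by []. Qed.

End exponents.

Lemma abel_sum_closed_form (R : realType) (a b c x : R) n : 0 < x ->
  (c / b) ^+ n * abel_sum a b n x =
  (c / b) ^+ n *
     \sum_(0 <= m < n)
       (x * (x + m%:R * a) ^ (m%:Z - 1) * b ^+ m / m`!%:R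
        * expR (- b * (m%:R * a + x))).
Proof.
move=> x0; congr (_ * _); apply: eq_bigr => m _.
have -> : expR (- b * (m%:R * a + x)) = expR (- b * a) ^+ m * expR (- b * x).
  by rewrite -expRM_natl -expRD; congr expR; ring.
rewrite exprMn.
(* Only [m = 0] has a negative exponent; there [x * x^-1 = 1] because [x] is positive. *)
case: m => [|m].
  rewrite /abel mul0r addr0 sub0r exprN1 divff ?gt_eqF// !expr0 (_ : 0`!%:R = 1)//.
  by rewrite invr1 !mulr1 !mul1r.
rewrite /abel (_ : m.+1%:Z - 1 = m)%R; last by rewrite -addn1 PoszD addrK.
rewrite -exprnP; ring.
Qed.

Lemma within_continuous_dist (R : realType) (f : R -> R) :
  {within `[0, +oo[%classic, continuous f} ->
  forall u, 0 <= u -> forall e, 0 < e ->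
  exists2 eta, 0 < eta & forall v, 0 <= v -> `|v - u| < eta -> `|f v - f u| < e.
Proof.
move=> cf u u0 e e0.
have Au : `[0, +oo[%classic u by rewrite /= in_itv /= u0.
have := cf u; rewrite /prop_for /continuous_at => Hc.
have : f t @[t --> within `[0, +oo[%classic (nbhs u)] --> f u.
  by rewrite nbhs_subspace_in.
move=> /cvgrPdist_lt /(_ _ e0).
rewrite near_withinE => /nbhs_ballP[eta /= eta0 Heta].
exists eta => // v v0 vu; rewrite distrC; apply: Heta.
  by rewrite /ball /= distrC.
by rewrite /= in_itv /= v0.
Qed.

(** * Upper and lower bounds for the expectation *)

Section drawdown_expectation.
Context d (T : measurableType d) (R : realType) (P : probability T R).
Variables (W : R -> {RV P >-> R}) (mu sigma lam : R).
Hypothesis hW : standard_brownian_motion W.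
Hypotheses (sigma0 : 0 < sigma) (lam0 : 0 < lam).
Variable n : nat.
Hypothesis n0 : (0 < n)%N.
Local Notation p := (beta_plus mu sigma lam).
Local Notation q := (- beta_minus mu sigma lam).
Local Notation X := (drifted_path mu sigma (fun t w => W t w)).
Local Notation Y := (mesh_payoff W mu sigma lam).
Local Notation V a y := (payoff_now p q a n y).
Local Notation D a w := (discount lam (drawdown_time a (X w) n)).

Let good : {ae P, forall w, X w 0 = 0 /\
  forall u, 0 <= u -> forall e, 0 < e ->
  exists2 eta, 0 < eta & forall v, 0 <= v -> `|v - u| < eta -> `|X w v - X w u| < e}.
Proof.
apply: filterS2 (sbm_start hW) (sbm_continuous hW) => w W0 Wc; split.
  by rewrite /drifted_path W0 !mulr0 addr0.
apply: within_continuous_dist => t.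
rewrite /drifted_path; apply: cvgD.
  apply: cvgM; first exact: cvg_cst.
  have cid : continuous (id : R -> R) by move=> ?; exact: cvg_id.
  have wid : {within `[0, +oo[%classic, continuous (id : R -> R)} by exact: continuous_subspaceT.
  exact: wid.
apply: cvgM; first exact: cvg_cst.
exact: Wc.
Qed.

Let mean_payoff a y i : R := fine (\int[P]_w (Y a n y i w)%:E)%E.

Let mean_combination (c0 s1 s2 s3 a1 a2 a3 y1 y2 y3 : R) i :
  0 < a1 -> 0 < a2 -> 0 < a3 ->
  (\int[P]_w (c0 + s1 * Y a1 n y1 i w + s2 * Y a2 n y2 i w + s3 * Y a3 n y3 i w)%:E =
   (c0 + s1 * mean_payoff a1 y1 i + s2 * mean_payoff a2 y2 i + s3 * mean_payoff a3 y3 i)%:E)%E.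
Proof.
move=> a10 a20 a30.
have I a y : 0 < a -> P.-integrable setT (fun w => (Y a n y i w)%:E).
  move=> a0; apply: (@bounded_integrable _ _ _ _ (Y a n y i) 1).
    exact: measurable_mesh_payoff.
  by move=> w; have /andP[u0 u1] := mesh_payoff01 W mu sigma a0 lam0 n y i w; rewrite ger0_norm.
have E a y : 0 < a -> (\int[P]_w (Y a n y i w)%:E = (mean_payoff a y i)%:E)%E.
  by move=> a0; rewrite fineK// integrable_fin_num//; exact: I.
have ID (g k : T -> R) (u v : R) :
    P.-integrable setT (EFin \o g) /\ (\int[P]_w (g w)%:E = u%:E)%E ->
    P.-integrable setT (EFin \o k) /\ (\int[P]_w (k w)%:E = v%:E)%E ->
    P.-integrable setT (EFin \o (fun w => g w + k w)) /\
    (\int[P]_w (g w + k w)%:E = (u + v)%:E)%E.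
  move=> [Ig Eg] [Ik Ek]; split.
    exact: (eq_integrable measurableT _ _ _ (integrableD measurableT Ig Ik)).
  under eq_integral do rewrite EFinD.
  by rewrite integralD// Eg Ek.
have IZ s a y : 0 < a -> P.-integrable setT (EFin \o (fun w => s * Y a n y i w)) /\
    (\int[P]_w (s * Y a n y i w)%:E = (s * mean_payoff a y i)%:E)%E.
  move=> a0; split.
    apply: (eq_integrable measurableT (fun w => (s%:E * (Y a n y i w)%:E)%E)) => //.
    by apply: integrableZl => //; exact: I.
  under eq_integral do rewrite EFinM.
  by rewrite integralZl// ?E//; exact: I.
have IC : P.-integrable setT (EFin \o (fun=> c0)) /\
    (\int[P]_w (c0%:E : \bar R) = c0%:E)%E.
  split; first exact: finite_measure_integrable_cst.
  by rewrite integral_cst//= probability_setT mule1.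
by have [] := ID _ _ _ _ (ID _ _ _ _ (ID _ _ _ _ IC (IZ s1 a1 y1 a10)) (IZ s2 a2 y2 a20)) (IZ s3 a3 y3 a30).
Qed.

Let measurable_combination (c0 s1 s2 s3 a1 a2 a3 y1 y2 y3 : R) i :
  measurable_fun [set: T]
    (fun w => c0 + s1 * Y a1 n y1 i w + s2 * Y a2 n y2 i w + s3 * Y a3 n y3 i w).
Proof.
have M s a y : measurable_fun [set: T] (fun w => s * Y a n y i w).
  by apply: measurable_funM => //; exact: measurable_mesh_payoff.
by apply: measurable_funD => //; apply: measurable_funD => //; apply: measurable_funD.
Qed.

Let near_mean a y eta : 0 < a -> 0 < eta ->
  \forall i \near \oo, V a y - eta <= mean_payoff a y i <= V a y + eta.
Proof.
move=> a0 eta0.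
have := mesh_payoff_expectation hW (beta_plus_gt0 mu sigma0 lam0)
  (beta_minus_lt0 mu sigma0 lam0) a0 lam0 (beta_plusE mu sigma0 lam0)
  (beta_minusE mu sigma0 lam0) n y eta0.
apply: filterS => i.
have -> : (\int[P]_w (Y a n y i w)%:E = (mean_payoff a y i)%:E)%E.
  have := @mean_combination 0 1 0 0 a a a y y y i a0 a0 a0.
  rewrite !mul0r !addr0 add0r mul1r => <-.
  by apply: eq_integral => w _; rewrite !mul0r !addr0 add0r mul1r.
by rewrite !lee_fin.
Qed.

Let payoff_grid a y i w : Y a n y i w =
  grid_payoff (X w) lam n (@mesh R) mesh_steps a y i.
Proof. by rewrite /mesh_payoff walk_grid. Qed.

Variables (a x : R).
Hypotheses (a0 : 0 < a) (x0 : 0 < x).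
Let exceeded w := (x%:E < running_max (X w) 0 (drawdown_time a (X w) n))%E.
Let f w : R := if exceeded w then D a w else 0.

(** Both discounts are compared with the payoff of the same walk, at level [u] and with the target
    marked as exceeded. *)
Let discount_mono w u v : X w 0 = 0 ->
  (forall u, 0 <= u -> forall e, 0 < e ->
  exists2 eta, 0 < eta & forall v, 0 <= v -> `|v - u| < eta -> `|X w v - X w u| < e) ->
  0 < u -> u < v -> D v w <= D u w.
Proof.
move=> X0 cX u0 uv; apply/ler_addgt0Pr => eta eta0.
have e2 : 0 < eta / 2 by lra.
near \oo => i.
have H1 : D v w <= grid_payoff (X w) lam n (@mesh R) mesh_steps u (-1) i + eta / 2.
  near: i; apply: near_discount_le_payoff => //.
  - exact: mesh_gt0.
  - exact: mesh_to0.
  - exact: mesh_steps_large.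
have H2 : grid_payoff (X w) lam n (@mesh R) mesh_steps u (-1) i <= D u w + eta / 2.
  near: i; apply: near_payoff_le_discount => //.
  exact: mesh_gt0.
lra.
Unshelve. all: by end_near. Qed.

(** Where [x] is exceeded, the walk at level [a] dominates in the limit only the discount at level
    [a + t]. The gap to the discount at level [a] is covered by the difference of the walks at
    levels [a - t] and [a + t] started at [-1]. Elsewhere monotonicity makes this difference
    nonnegative in the limit. *)
Lemma expectation_le (t : R) : 0 < t < a ->
  (\int[P]_w (f w)%:E <= (V a x + V (a - t) (- 1) - V (a + t) (- 1))%:E)%E.
Proof.
have bounds (u v w : R) : 0 <= u <= 1 -> 0 <= v <= 1 -> 0 <= w <= 1 ->
    0 <= 1 + 1 * u + 1 * v + (- 1) * w.
  by move=> /andP[? ?] /andP[? ?] /andP[? ?]; lra.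
have regroup (u v w : R) : u + v - w = (1 + u + v - w) - 1 by ring.
have means (u v w mu' mv mw eta : R) : u - eta / 3 <= mu' <= u + eta / 3 ->
    v - eta / 3 <= mv <= v + eta / 3 -> w - eta / 3 <= mw <= w + eta / 3 ->
    1 + 1 * mu' + 1 * mv + (- 1) * mw <= 1 + u + v - w + eta.
  by move=> /andP[? ?] /andP[? ?] /andP[? ?]; lra.
have pointwise (D1 D2 g1 g2 g3 eta : R) : D1 <= g2 + eta / 3 -> g3 <= D2 + eta / 3 ->
    D2 <= g1 + eta / 3 -> D1 + 1 <= 1 + 1 * g1 + 1 * g2 + (- 1) * g3 + eta by lra.
have pointwise0 (D1 D2 g1 g2 g3 eta : R) : 0 < eta -> D1 <= g2 + eta / 3 ->
    g3 <= D2 + eta / 3 -> D2 <= D1 -> 0 <= g1 ->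
    0 + 1 <= 1 + 1 * g1 + 1 * g2 + (- 1) * g3 + eta by lra.
move=> /andP[t0 ta].
have at1 : 0 < a - t by lra.
have at2 : 0 < a + t by lra.
have ata : a - t < a by lra.
have aat : a < a + t by lra.
(* The leading [1] keeps [Z] nonnegative for Fatou's lemma, since a payoff with coefficient [-1] is
   at most [1]. *)
pose Z i w := 1 + 1 * Y a n x i w + 1 * Y (a - t) n (- 1) i w + (- 1) * Y (a + t) n (- 1) i w.
rewrite regroup; apply: (@integral_le_fatou _ _ _ P Z) => //.
- by move=> i; exact: measurable_combination.
- by move=> i w; apply: bounds; exact: mesh_payoff01.
- move=> eta eta0; have e3 : 0 < eta / 3 by rewrite divr_gt0.
  apply: filterS3 (near_mean x a0 e3) (near_mean (-1) at1 e3) (near_mean (-1) at2 e3) => i.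
  move=> H1 H2 H3; rewrite /Z mean_combination// lee_fin.
  exact: means H1 H2 H3.
- by move=> w; rewrite /f; case: ifP => // _; have /andP[] := discount01 (X w) n lam0 a.
apply: filterS good => w [X0 cX] eta eta0.
have e3 : 0 < eta / 3 by rewrite divr_gt0.
have H1 := near_discount_le_payoff lam0 n0 X0 cX (@mesh_gt0 R) (@mesh_to0 R)
  (@mesh_steps_large R) (ltrN10 R) at1 ata e3.
have H2 := near_payoff_le_discount mesh_steps lam0 n0 X0 (@mesh_gt0 R) (- 1) at2 e3.
rewrite /f; case: ifP => ex.
  have H3 := near_discount_le_payoff_exceeded lam0 n0 X0 cX (@mesh_gt0 R) (@mesh_to0 R)
    (@mesh_steps_large R) (ltW x0) a0 aat e3 ex.
  apply: filterS3 H1 H2 H3 => i; rewrite /Z !payoff_grid; exact: pointwise.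
have mono := discount_mono X0 cX a0 aat.
apply: filterS2 H1 H2 => i; rewrite /Z !payoff_grid => H1 H2.
apply: pointwise0 H1 H2 mono _ => //.
by apply: grid_payoff_ge0 => //; exact: mesh_gt0.
Qed.

(** Raising the target to [x + t] and lowering the level to [a - t] makes the payoff vanish where
    [x] is not exceeded. Elsewhere it is at most the discount at level [a - t]; the excess over the
    discount at level [a] is removed with walks at levels [a - 2 t] and [a]. *)
Lemma expectation_ge (t : R) : 0 < t -> 2 * t < a ->
  ((V (a - t) (x + t) - V (a - 2 * t) (- 1) + V a (- 1))%:E <= \int[P]_w (f w)%:E)%E.
Proof.
have bounds (u v w : R) : 0 <= u <= 1 -> 0 <= v <= 1 -> 0 <= w <= 1 ->
    0 <= 2 + (- 1) * u + 1 * v + (- 1) * w.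
  by move=> /andP[? ?] /andP[? ?] /andP[? ?]; lra.
have regroup (u v w : R) : u - v + w = 2 - (2 - u + v - w) by ring.
have means (u v w mu' mv mw eta : R) : u - eta / 3 <= mu' <= u + eta / 3 ->
    v - eta / 3 <= mv <= v + eta / 3 -> w - eta / 3 <= mw <= w + eta / 3 ->
    2 + (- 1) * mu' + 1 * mv + (- 1) * mw <= 2 - u + v - w + eta.
  by move=> /andP[? ?] /andP[? ?] /andP[? ?]; lra.
have pointwise (D1 D2 g1 g2 g3 eta : R) : D2 <= g2 + eta / 3 -> g3 <= D1 + eta / 3 ->
    g1 <= D2 + eta / 3 -> 2 - D1 <= 2 + (- 1) * g1 + 1 * g2 + (- 1) * g3 + eta by lra.
have pointwise0 (D1 D2 g1 g2 g3 eta : R) : 0 < eta -> D2 <= g2 + eta / 3 ->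
    g3 <= D1 + eta / 3 -> D1 <= D2 -> g1 = 0 ->
    2 - 0 <= 2 + (- 1) * g1 + 1 * g2 + (- 1) * g3 + eta by move=> ? ? ? ? ->; lra.
move=> t0 ta.
have at1 : 0 < a - t by lra.
have at2 : 0 < a - 2 * t by lra.
have ata : a - 2 * t < a - t by lra.
have aat : a - t < a by lra.
have xt : x < x + t by lra.
have xt0 : 0 <= x + t by rewrite addr_ge0 ?ltW.
pose Z i w := 2 + (- 1) * Y (a - t) n (x + t) i w + 1 * Y (a - 2 * t) n (- 1) i w + (- 1) * Y a n (- 1) i w.
rewrite regroup; apply: (@integral_ge_fatou _ _ _ P Z) => //.
- by move=> i; exact: measurable_combination.
- by move=> i w; apply: bounds; exact: mesh_payoff01.
- move=> eta eta0; have e3 : 0 < eta / 3 by rewrite divr_gt0.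
  apply: filterS3 (near_mean (x + t) at1 e3) (near_mean (-1) at2 e3) (near_mean (-1) a0 e3) => i.
  move=> H1 H2 H3; rewrite /Z mean_combination// lee_fin.
  exact: means H1 H2 H3.
- by move=> w; rewrite /f; case: ifP => // _; have /andP[] := discount01 (X w) n lam0 a.
apply: filterS good => w [X0 cX] eta eta0.
have e3 : 0 < eta / 3 by rewrite divr_gt0.
have H1 := near_discount_le_payoff lam0 n0 X0 cX (@mesh_gt0 R) (@mesh_to0 R)
  (@mesh_steps_large R) (ltrN10 R) at2 ata e3.
have H2 := near_payoff_le_discount mesh_steps lam0 n0 X0 (@mesh_gt0 R) (- 1) a0 e3.
rewrite /f; case: ifP => ex.
  have H3 := near_payoff_le_discount mesh_steps lam0 n0 X0 (@mesh_gt0 R) (x + t) at1 e3.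
  apply: filterS3 H1 H2 H3 => i; rewrite /Z !payoff_grid; exact: pointwise.
have mono := discount_mono X0 cX at1 aat.
have nex : ~ (x%:E < running_max (X w) 0 (drawdown_time a (X w) n))%E by move/negP: (negbT ex).
have H3 := near_payoff_not_exceeded lam n0 X0 cX (@mesh_gt0 R) (@mesh_to0 R)
  (@mesh_steps_large R) xt xt0 at1 aat nex.
apply: filterS3 H1 H2 H3 => i; rewrite /Z !payoff_grid => H1 H2 H3.
exact: pointwise0 H1 H2 mono H3.
Qed.

End drawdown_expectation.

(** * Removing the perturbation of level and target *)

Section vanishing_perturbation.
Context {R : realType}.
Variables (p q a x : R) (n : nat).
Hypotheses (p0 : 0 < p) (q0 : 0 < q) (a0 : 0 < a) (x0 : 0 < x).
Local Notation V a y := (payoff_now p q a n y).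

Let cvg_shift (u k : R) : u + k * t @[t --> (0 : R)^'+] --> u.
Proof.
rewrite -[X in _ --> X]addr0 -[X in _ + X](mulr0 k).
apply: cvgD; first exact: cvg_cst.
by apply: cvgM; [exact: cvg_cst|exact/cvg_at_right_filter/cvg_id].
Qed.

(** At a negative distance the value is [(c / b) ^ n], the transform of the drawdown time alone. *)
Let cvg_flagged (k : R) : V (a + k * t) (- 1) @[t --> (0 : R)^'+] --> V a (- 1).
Proof.
rewrite /payoff_now ltrN10; apply: cvgM; last exact: cvg_cst.
by apply: cvg_total_weight => //; exact: cvg_shift.
Qed.

Let V_pos b y : 0 <= y ->
  V b y = total_weight p q b n * abel_sum b (exit_b p q b) n y.
Proof. by move=> y0; rewrite /payoff_now ltNge y0. Qed.

Let cvg_positive :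
  total_weight p q (a + - 1 * t) n *
    abel_sum (a + - 1 * t) (exit_b p q (a + - 1 * t)) n (x + 1 * t)
    @[t --> (0 : R)^'+] --> V a x.
Proof.
rewrite (V_pos _ (ltW x0)); apply: cvgM.
  by apply: cvg_total_weight => //; exact: cvg_shift.
by apply: cvg_abel_sum => //; exact: cvg_shift.
Qed.

Lemma perturbation_le (e : R) : 0 < e -> exists2 t, 0 < t < a &
  V a x + V (a - t) (- 1) - V (a + t) (- 1) <= V a x + e.
Proof.
move=> e0; have e2 : 0 < e / 2 by rewrite divr_gt0.
have /cvgrPdist_lt/(_ _ e2) C1 := @cvg_flagged (- 1).
have /cvgrPdist_lt/(_ _ e2) C2 := @cvg_flagged 1.
have [t [[t0 ta] [H1 H2]]] := @filter_ex _ (0 : R)^'+ _ _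
  (filterI (filterI (nbhs_right_gt 0) (nbhs_right_lt a0)) (filterI C1 C2)).
exists t; first by rewrite t0.
move: H1 H2; rewrite mulN1r mul1r.
move: (V a x) (V a _) (V (a - t) _) (V (a + t) _) => v1 v2 v3 v4.
by rewrite !ltr_norml => /andP[? ?] /andP[? ?]; lra.
Qed.

Lemma perturbation_ge (e : R) : 0 < e -> exists t, [/\ 0 < t, 2 * t < a &
  V a x - e <= V (a - t) (x + t) - V (a - 2 * t) (- 1) + V a (- 1)].
Proof.
move=> e0; have e2 : 0 < e / 2 by rewrite divr_gt0.
have a2 : 0 < a / 2 by rewrite divr_gt0.
have /cvgrPdist_lt/(_ _ e2) C1 := cvg_positive.
have /cvgrPdist_lt/(_ _ e2) C2 := @cvg_flagged (- 2).
have [t [[t0 ta] [H1 H2]]] := @filter_ex _ (0 : R)^'+ _ _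
  (filterI (filterI (nbhs_right_gt 0) (nbhs_right_lt a2)) (filterI C1 C2)).
exists t; split=> //; first by move: ta; rewrite ltr_pdivlMr// mulrC.
have xt : 0 <= x + t by rewrite addr_ge0 ?ltW.
move: H1 H2; rewrite mulN1r mul1r mulNr -V_pos//.
move: (V a x) (V a (- 1)) (V (a - t) _) (V (a - 2 * t) _) => v1 v2 v3 v4.
by rewrite !ltr_norml => /andP[? ?] /andP[? ?]; lra.
Qed.

End vanishing_perturbation.

(* At m = 0 the integer power is x^(-1), so x * (x + m a)^(m - 1) = 1. *)
Theorem corollary4p1 (d : measure_display) (T : measurableType d)
    (R : realType) (P : probability T R) (W : R -> {RV P >-> R})
    (mu sigma a : R)
    (hW : standard_brownian_motion W) (hsigma : 0 < sigma) (ha : 0 < a)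
    (lambda : R) (hlambda : 0 < lambda)
    (n : nat) (hn : (1 <= n)%N) (x : R) (hx : 0 < x) :
  let X := drifted_path mu sigma (fun t w => W t w) in
  let tau := fun w => drawdown_time a (X w) n in
  let b := b_coef mu sigma a lambda in
  let c := c_coef mu sigma a lambda in
  expectation_on P (fun w => discount lambda (tau w))
    [set w | (x%:E < running_max (X w) 0%E (tau w))%E]
  = ((c / b) ^+ n *
     \sum_(0 <= m < n)
       (x * (x + m%:R * a) ^ (m%:Z - 1) * b ^+ m / m`!%:R
        * expR (- b * (m%:R * a + x))))%:E.
Proof.
move=> X tau b c; rewrite /expectation_on unlock.
set p := beta_plus mu sigma lambda; set q := - beta_minus mu sigma lambda.
have p0 : 0 < p by exact: beta_plus_gt0.
have q0 : 0 < q by exact: beta_minus_lt0.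
have <- : payoff_now p q a n x =
  (c / b) ^+ n *
     \sum_(0 <= m < n)
       (x * (x + m%:R * a) ^ (m%:Z - 1) * b ^+ m / m`!%:R
        * expR (- b * (m%:R * a + x))).
  rewrite -abel_sum_closed_form// /payoff_now ltNge (ltW hx) /= /b /c.
  by rewrite b_coefE c_coefE.
have -> : (fun w => (discount lambda (tau w) *
      \1_[set w | (x%:E < running_max (X w) 0%E (tau w))%E] w)%:E) =
    (fun w => (if (x%:E < running_max (X w) 0%E (tau w))%E
               then discount lambda (tau w) else 0)%:E).
  apply/funext => w; congr (_%:E); rewrite indicE.
  by case: ifP => h; [rewrite mem_set//= mulr1|rewrite memNset/= ?mulr0// h].
apply/eqP; rewrite eq_le; apply/andP; split.
  apply/lee_addgt0Pr => e e0.
  have [t t01 Ht] := perturbation_le x n p0 q0 ha e0.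
  apply: le_trans (expectation_le mu hW hsigma hlambda hn ha hx t01) _.
  by rewrite -EFinD lee_fin.
apply/lee_subgt0Pr => e e0.
have [t [t0 t2 Ht]] := perturbation_ge n p0 q0 ha hx e0.
apply: le_trans (expectation_ge mu hW hsigma hlambda hn ha hx t0 t2).
by rewrite -EFinB lee_fin.
Qed.
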